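(* For every integer $d \geq 1$ there is a constant $c_d > 0$ depending only on $d$ such that the following holds. Let $m \geq 1$ be an integer, let $N = m^d$, and let $(x_k)_{k=1}^{N}$ be the regular grid of $N$ points in $[0,1]^d$. Then for all differentiable $f:[0,1]^d \rightarrow \mathbb{R}$ $$ \left| \int_{[0,1]^d} f(x)\, dx - \frac{1}{N} \sum_{k=1}^{N} f(x_k) \right| \leq c_d\, \| \nabla f\|^{(d-1)/d}_{L^{\infty}([0,1]^d)}\, \| \nabla f\|^{1/d}_{L^{1}([0,1]^d)}\, N^{-1/d}.$$
   Context: The regular grid with $N = m^d$ points consists of the centers of the $m^d$ congruent axis-parallel subcubes of side length $1/m = N^{-1/d}$ into which $[0,1]^d$ is divided, i.e. the points $\left(\frac{2 i_1 - 1}{2m}, \dots, \frac{2 i_d - 1}{2m}\right)$ with $i_1,\dots,i_d \in \{1,\dots,m\}$. $\|\nabla f\|_{L^p}$ denotes the $L^p$ norm of the Euclidean length $|\nabla f|$; if the right-hand side is infinite the inequality is understood to be trivially true. *)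

(* Defs.v *)
From HB Require Import structures.
From mathcomp Require Import all_boot all_order all_algebra.
From mathcomp Require Import all_classical all_reals all_analysis.

Set Implicit Arguments.
Unset Strict Implicit.
Unset Printing Implicit Defensive.

Import Order.TTheory GRing.Theory Num.Theory.
Import numFieldNormedType.Exports.

Local Open Scope classical_set_scope.
Local Open Scope ring_scope.

(* Row vectors carry the sigma-algebra generated by the coordinate maps, as the
   library does for tuples. *)
Definition measure_rV_display : measure_display -> measure_display.
Proof. exact. Qed.

Section measurable_rV.
Context {d} {T : measurableType d}.
Variable n : nat.

Let coors : 'I_n -> 'rV[T]_n -> T := fun i v => v ord0 i.

Let rV_set0 : g_sigma_preimage coors set0.
Proof. exact: sigma_algebra0. Qed.

Let rV_setC A : g_sigma_preimage coors A -> g_sigma_preimage coors (~` A).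
Proof. exact: sigma_algebraC. Qed.

Let rV_bigcup (F : _^nat) : (forall i, g_sigma_preimage coors (F i)) ->
  g_sigma_preimage coors (\bigcup_i (F i)).
Proof. exact: sigma_algebra_bigcup. Qed.

HB.instance Definition _ := @isMeasurable.Build (measure_rV_display d)
  ('rV[T]_n) (g_sigma_preimage coors) rV_set0 rV_setC rV_bigcup.

End measurable_rV.

Lemma measurable_rV_coord d (T : measurableType d) n (i : 'I_n) :
  measurable_fun [set: 'rV[T]_n] (fun v : 'rV[T]_n => v ord0 i).
Proof.
move=> _ Y mY; rewrite setTI; apply: sub_sigma_algebra => /=.
rewrite -bigcup_seq/=; exists i => /=; first by rewrite mem_index_enum.
by exists Y => //; rewrite setTI.
Qed.

Lemma measurable_rV_box d (T : measurableType d) n (A : 'I_n -> set T) :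
  (forall i, measurable (A i)) ->
  measurable [set v : 'rV[T]_n | forall i, A i (v ord0 i)].
Proof.
move=> mA.
rewrite (_ : [set v | _] = \bigcap_(i in [set: 'I_n])
    ((fun v : 'rV[T]_n => v ord0 i) @^-1` A i)); last first.
  by apply/seteqP; split => v /= Av i; [move=> _|]; exact: Av.
apply: fin_bigcap_measurable => // i _.
by rewrite -[X in measurable X]setTI; exact: measurable_rV_coord.
Qed.

Lemma measurable_fun_rVP d1 d2 (T1 : measurableType d1)
    (T2 : measurableType d2) n (f : T1 -> 'rV[T2]_n) :
  (forall i, measurable_fun [set: T1] (fun x => f x ord0 i)) ->
  measurable_fun [set: T1] f.
Proof.
move=> mf.
pose g (i : 'I_n) (x : T1) := f x ord0 i.
have gE : g_sigma_preimage g =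
    preimage_set_system [set: T1] f
      (g_sigma_preimage (fun (i : 'I_n) (v : 'rV[T2]_n) => v ord0 i)).
  exact: (g_sigma_preimage_comp (fun (i : 'I_n) (v : 'rV[T2]_n) => v ord0 i)).
suff prefS : g_sigma_preimage g `<=` measurable.
  by move=> _ A mA; apply: prefS; rewrite gE; exists A.
apply: smallest_sub; first exact: sigma_algebra_measurable.
rewrite -bigcup_seq; apply: bigcup_sub => i _ A [B mB <-].
exact: mf.
Qed.

Section lebesgue_rV.
Context {R : realType}.

Definition rV_cons n (p : measurableTypeR R * 'rV[R]_n) : 'rV[R]_n.+1 :=
  \row_i oapp (p.2 ord0) p.1 (unlift ord0 i).

Lemma rV_cons0 n p : @rV_cons n p ord0 ord0 = p.1.
Proof. by rewrite mxE unlift_none. Qed.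

Lemma rV_consS n p i : @rV_cons n p ord0 (lift ord0 i) = p.2 ord0 i.
Proof. by rewrite mxE liftK. Qed.

Lemma measurable_rV_cons n : measurable_fun setT (@rV_cons n).
Proof.
apply: measurable_fun_rVP => i; case: (unliftP ord0 i) => [j|] ->.
  under eq_fun do rewrite rV_consS.
  exact: (measurableT_comp (measurable_rV_coord j) measurable_snd).
under eq_fun do rewrite rV_cons0.
exact: measurable_fst.
Qed.

Section step.
Local Open Scope ereal_scope.
Variables (n : nat) (mu : {sigma_finite_measure set 'rV[R]_n -> \bar R}).

Definition lebesgue_rV_step : set 'rV[R]_n.+1 -> \bar R :=
  pushforward (lebesgue_measure \x mu) (@rV_cons n).

Let step0 : lebesgue_rV_step set0 = 0.
Proof. by rewrite /lebesgue_rV_step /pushforward preimage_set0 measure0. Qed.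

Let step_ge0 A : 0 <= lebesgue_rV_step A.
Proof. exact: (measure_ge0 (lebesgue_measure \x mu)). Qed.

Let step_sigma_additive : semi_sigma_additive lebesgue_rV_step.
Proof.
move=> F mF tF mUF; rewrite /lebesgue_rV_step /pushforward preimage_bigcup.
have mpre A : measurable A -> measurable (@rV_cons n @^-1` A).
  by move=> mA; rewrite -[X in measurable X]setTI; exact: measurable_rV_cons.
apply: measure_semi_sigma_additive.
- by move=> k; exact: mpre.
- apply/trivIsetP => /= i j _ _ ij; rewrite -preimage_setI.
  by move/trivIsetP : tF => /(_ _ _ _ _ ij) ->//; rewrite preimage_set0.
- by rewrite -preimage_bigcup; exact: mpre.
Qed.

HB.instance Definition _ := isMeasure.Build _ _ _ lebesgue_rV_step
  step0 step_ge0 step_sigma_additive.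

Lemma lebesgue_rV_step_box (A : set R) (B : set 'rV[R]_n) :
  measurable A -> measurable B ->
  lebesgue_rV_step
    [set v | A (v ord0 ord0) /\ B (\row_i v ord0 (lift ord0 i))] =
  lebesgue_measure A * mu B.
Proof.
move=> mA mB; rewrite /lebesgue_rV_step /pushforward.
rewrite -(product_measure1E lebesgue_measure mu mA mB).
congr (product_measure1 _ _ _); apply/seteqP.
have rowK p : (\row_i @rV_cons n p ord0 (lift ord0 i) = p.2)%R.
  by apply/rowP => i; rewrite mxE rV_consS.
by split => p /=; rewrite rowK rV_cons0.
Qed.

Let step_sigma_finite : sigma_finite setT lebesgue_rV_step.
Proof.
have /sigma_finiteP[F [TF ndF Foo]] := sigma_finiteT (@lebesgue_measure R).
have /sigma_finiteP[G [TG ndG Goo]] := sigma_finiteT mu.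
exists (fun k => [set v : 'rV[R]_n.+1 |
    F k (v ord0 ord0) /\ G k (\row_i v ord0 (lift ord0 i))%R]).
  apply/seteqP; split => // v _.
  have : setT (v ord0 ord0) by [].
  rewrite TF => -[i _ Fi].
  have : setT (\row_i v ord0 (lift ord0 i))%R by [].
  rewrite TG => -[j _ Gj].
  exists (maxn i j) => //=; split.
  - by move: Fi; apply/subsetPset/ndF/leq_maxl.
  - by move: Gj; apply/subsetPset/ndG/leq_maxr.
move=> k; have [mF Fk] := Foo k; have [mG Gk] := Goo k; split.
  apply: measurableI.
    by rewrite -[X in measurable X]setTI; exact: measurable_rV_coord.
  rewrite -[X in measurable X]setTI.
  apply: (_ : measurable_fun setT
    (fun v : 'rV[R]_n.+1 => \row_i v ord0 (lift ord0 i))%R) => //.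
  apply: measurable_fun_rVP => i.
  by under eq_fun do rewrite mxE; exact: measurable_rV_coord.
by rewrite lebesgue_rV_step_box// lte_mul_pinfty// ge0_fin_numE.
Qed.

HB.instance Definition _ := Measure_isSigmaFinite.Build _ _ _ lebesgue_rV_step
  step_sigma_finite.

End step.

(* Lebesgue measure on R^n: on R^0 the unit mass at the only point, then
   lebesgue_measure on the first coordinate times the measure on the others. *)
Fixpoint lebesgue_rV (n : nat) : {sigma_finite_measure set 'rV[R]_n -> \bar R} :=
  match n with
  | 0 => dirac (0 : 'rV[R]_0)
  | n'.+1 => lebesgue_rV_step (lebesgue_rV n')
  end.

Lemma lebesgue_rV_box n (A : 'I_n -> set R) :
  (forall i, measurable (A i)) ->
  lebesgue_rV n [set v | forall i, A i (v ord0 i)] =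
  (\prod_(i < n) lebesgue_measure (A i))%E.
Proof.
elim: n A => [|n IHn] A mA.
  by rewrite big_ord0 /= diracE mem_set// => -[].
rewrite big_ord_recl -IHn//= -lebesgue_rV_step_box//; last first.
  exact: (measurable_rV_box (fun i => mA (lift ord0 i))).
congr (lebesgue_rV_step _ _); apply/seteqP; split => v /=.
  by move=> Av; split=> // i; rewrite mxE.
by move=> [A0 AS] i; case: (unliftP ord0 i) => [j|] -> //; have := AS j; rewrite mxE.
Qed.

End lebesgue_rV.

Section cube.
Context {R : realType} (d : nat).

Definition unit_cube : set 'rV[R]_d :=
  [set x | forall j, x ord0 j \in `[0, 1]].

Definition grid_point (m : nat) (i : {ffun 'I_d -> 'I_m}) : 'rV[R]_d :=
  \row_j ((2 * (i j).+1%:R - 1) / (2 * m%:R)).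

Lemma lim_within_cube (x : 'rV[R]_d) :
  unit_cube x -> lim (within unit_cube (nbhs x)) = x.
Proof.
move=> xQ.
have PF : ProperFilter (within unit_cube (nbhs x)).
  exact: within_nbhs_proper (subset_closure xQ).
apply: (@cvg_lim _ (@norm_hausdorff _ _) _ _ PF id x).
exact: cvg_within.
Qed.

(* Differentiability and differential are taken along the trace on the cube of
   the neighbourhoods of x, so they are one-sided on the boundary and only see
   the values on the cube. By lim_within_cube the base point of the expansion
   is x, and the differential is unique at every point of the cube, boundary
   included, as the cube is the closure of its interior and convex. *)
Definition cube_differentiable (f : 'rV[R]_d -> R) : Prop :=
  forall x, unit_cube x -> differentiable f (within unit_cube (nbhs x)).

Definition cube_gradient (f : 'rV[R]_d -> R) (x : 'rV[R]_d) : 'rV[R]_d :=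
  \row_j 'd f (within unit_cube (nbhs x)) (delta_mx ord0 j).

Definition euclidean_norm (v : 'rV[R]_d) : R :=
  Num.sqrt (\sum_j v ord0 j ^+ 2).

Definition cube_gradient_Lnorm (p : \bar R) (f : 'rV[R]_d -> R) : \bar R :=
  'N[lebesgue_rV d]_p
    [(fun x => (euclidean_norm (cube_gradient f x))%:E) \_ unit_cube].

End cube.

(* Main.v *)
Require Import Defs.
From mathcomp Require Import all_boot all_order all_algebra.
From mathcomp Require Import all_classical all_reals all_analysis.
From mathcomp Require Import measurable_realfun.
From mathcomp Require Import ring lra.

Set Implicit Arguments.
Unset Strict Implicit.
Unset Printing Implicit Defensive.

Import Order.TTheory GRing.Theory Num.Theory.
Import numFieldNormedType.Exports.

Local Open Scope classical_set_scope.
Local Open Scope ring_scope.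
Local Open Scope ereal_scope.

(** On a cube Q of side h centred at a grid point c, the value f c is compared
    with the mean of f over Q through the mean over a concentric cube of a
    smaller side r, to be chosen later.

    Two concentric cubes are compared one coordinate at a time. Replacing the
    side of the j-th edge of a box changes the mean of f by at most the mean,
    over the remaining coordinates, of the oscillation of f along lines in
    direction j, and that oscillation is at most the integral of |grad f| over
    the line. As all the edges of the intermediate boxes have length at least r,
    the means over the cubes of sides w >= r differ by at most
    d r^(1-d) \int |grad f| over the larger one ([hcube_compare],
    [cube_avg_compare]).

    Used with w = h this bounds the passage from Q to the cube of side r by
    d r^(1-d) times the L^1 norm of the gradient on Q. Used along the sides
    r, r/2, r/4, ... it bounds the passage from the cube of side r to its centre
    by d 2^d M r, where M is the essential supremum of |grad f|
    ([cube_avg_lipschitz]), as the means tend to f c by continuity.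

    Summation over the grid gives, with I the L^1 norm over the whole cube and
    h = 1/m,
      error <= m^(-d) d r^(1-d) I + d 2^d M r   for every 0 < r <= 1/m,
    and r = (I/M)^(1/d) / m balances the two terms ([optimal_scale]); this r is
    admissible because I <= M. When d = 1 or I = 0 the first term does not
    depend on r and r -> 0 suffices ([quadrature_error_L1]); otherwise an
    infinite M makes the right-hand side infinite.

    The inequality |f b - f a| <= \int |f'| on a line is needed for functions
    which are differentiable at every point but whose derivative may be
    unbounded and discontinuous: it is [dini_le_integral], proved with a lower
    semicontinuous majorant of |f'| ([lsc_majorant]). *)

(** * Increments of everywhere differentiable functions of one variable *)

Section derivative_bound.
Context {R : realType}.
Let mu := @lebesgue_measure R.

(** The Vitali-Caratheodory construction: [D] is sliced into the level sets
    [E n] where g lies in [d n, d (n+1)[ for a small step d, each slice is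
    enclosed in an open set, and the constants d (n+1) are spread over these open
    sets. The majorant is strict, which leaves the room that an estimate on
    difference quotients needs. *)
Lemma lsc_majorant (D : set (measurableTypeR R)) (g : measurableTypeR R -> R)
    (e : R) : (0 < e)%R ->
  measurable D -> mu D < +oo -> measurable_fun D g ->
  (forall x, D x -> (0 <= g x)%R) ->
  exists u : measurableTypeR R -> \bar R,
    [/\ measurable_fun [set: measurableTypeR R] u, forall x, 0 <= u x,
        forall x, D x -> exists r, exists U : set R,
          [/\ (g x < r)%R, open U, U x & forall y, U y -> r%:E <= u y] &
        \int[mu]_(x in D) u x <= \int[mu]_(x in D) (g x)%:E + e%:E].
Proof.
move=> e0 mD muD mg g0.
have [l l0 lE] : exists2 l, (0 <= l)%R & mu D = l%:E.
  have : mu D \is a fin_num by rewrite ge0_fin_numE.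
  by move=> /fineK; exists (fine (mu D)) => //; exact: fine_ge0.
(* Rounding g up to a multiple of d costs at most d times the measure of D,
   that is at most half of e. *)
pose d := (e / 2 / (l + 1))%R.
have d0 : (0 < d)%R by rewrite !divr_gt0// ltr_wpDl.
have dl : (d * l <= e / 2)%R.
  rewrite /d mulrAC ler_pdivrMr ?ltr_wpDl// ler_wpM2l ?lerDl//.
  by rewrite divr_ge0// ltW.
move: d d0 dl => d d0 dl.
pose E n : set (measurableTypeR R) := D `&` g @^-1` `[(d * n%:R)%R, (d * n.+1%:R)%R[%classic.
have mE n : measurable (E n) by exact: mg.
have EmuD n : mu (E n) < +oo.
  apply: le_lt_trans muD; apply: le_measure; rewrite ?inE//.
  exact: subIsetl.
(* The error of the n-th slice is weighted by d (n+1), hence the division. *)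
have hO n : exists U : set R, [/\ open U, E n `<=` U &
    mu (U `\` E n) < (e / 2 / (2 ^ n.+1)%:R / (d * n.+1%:R))%:E].
  apply: lebesgue_regularity_outer => //; first exact: mE.
  by rewrite !divr_gt0// ?ltr0n ?expn_gt0// mulr_gt0.
have [V VP] : {V : nat -> set (measurableTypeR R) & forall n, [/\ open (V n : set R), E n `<=` V n &
    mu (V n `\` E n) < (e / 2 / (2 ^ n.+1)%:R / (d * n.+1%:R))%:E]} := choice hO.
have mV n : measurable (V n) by apply: open_measurable; have [] := VP n.
pose w n : \bar R := (d * n.+1%:R)%:E.
have w0 n : 0 <= w n by rewrite lee_fin mulr_ge0// ltW.
have mi (A : set (measurableTypeR R)) n : measurable A ->
    measurable_fun [set: measurableTypeR R] (fun x => w n * (\1_A x)%:E).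
  by move=> mA; apply: measurable_funeM; apply/measurable_EFinP;
    exact: measurable_indic.
pose u (x : measurableTypeR R) := \sum_(0 <= n <oo) w n * (\1_(V n) x)%:E.
have wi0 (A : set (measurableTypeR R)) n x : 0 <= w n * (\1_A x)%:E.
  by rewrite mule_ge0// lee_fin.
have int_series (A : (set (measurableTypeR R))^nat) : (forall n, measurable (A n)) ->
    \int[mu]_(x in D) \sum_(0 <= n <oo) w n * (\1_(A n) x)%:E =
    \sum_(0 <= n <oo) w n * mu (A n `&` D).
  move=> mA; rewrite integral_nneseries//; last first.
    by move=> n; apply: measurable_funTS; exact: mi.
  apply: eq_eseriesr => n _.
  rewrite ge0_integralZl_EFin//; first by rewrite integral_indic//.
  - by apply: measurable_funTS; apply/measurable_EFinP; exact: measurable_indic.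
  - by rewrite mulr_ge0// ltW.
exists u; split.
- by apply: ge0_emeasurable_sum => [//|n _]; exact: mi.
- by move=> x; apply: nneseries_ge0 => n _.
- move=> x Dx; pose n := Num.truncn (g x / d).
  have /andP[gn1 gn2] : (d * n%:R <= g x < d * n.+1%:R)%R.
    have gd : (0 <= g x / d)%R by rewrite divr_ge0 ?g0// ltW.
    have /andP[] := truncn_itv gd.
    by rewrite ler_pdivlMr// ltr_pdivrMr// !(mulrC d) => -> ->.
  have [oV EV _] := VP n.
  exists (d * n.+1%:R)%R, (V n); split => //.
    by apply: EV; split => //=; rewrite in_itv/= gn1 gn2.
  move=> y Vy; rewrite /u (@nneseriesD1 _ _ n)//.
  rewrite indicE mem_set// mule1 leeDl//.
  by apply: nneseries_ge0.
- rewrite /u int_series//.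
  apply: (@le_trans _ _ (\sum_(0 <= n <oo) (w n * mu (E n) + (e / 2 / (2 ^ n.+1)%:R)%:E))).
    apply: lee_nneseries => [n _ _|n _]; first by rewrite mule_ge0.
    have [_ EV VE] := VP n.
    have wn0 : (0 < d * n.+1%:R)%R by rewrite mulr_gt0.
    have -> : (e / 2 / (2 ^ n.+1)%:R)%:E =
        w n * (e / 2 / (2 ^ n.+1)%:R / (d * n.+1%:R))%:E.
      by rewrite /w -EFinM [in RHS]mulrC divfK// gt_eqF.
    rewrite -ge0_muleDr//; last exact: le_trans (measure_ge0 mu _) (ltW VE).
    rewrite lee_wpmul2l//.
    apply: (@le_trans _ _ (mu (E n `|` (V n `\` E n)))).
      apply: le_measure; rewrite ?inE//.
      - exact: measurableI.
      - by apply: measurableU => //; exact: measurableD.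
      - by move=> x [Vx _]; have [Ex|Ex] := pselect (E n x); [left|right].
    apply: le_trans (measureU2 _ _ _) _ => //; first exact: measurableD.
    by rewrite leeD2l// ltW.
  apply: le_trans (epsilon_trick _ _ _) _.
  - by move=> n; rewrite mule_ge0.
  - by rewrite divr_ge0// ltW.
  have -> : \sum_(0 <= n <oo) w n * mu (E n) = \sum_(0 <= n <oo) w n * mu (E n `&` D).
    by apply: eq_eseriesr => n _; congr (_ * mu _); rewrite setIC setIA setIid.
  rewrite -int_series//.
  apply: (@le_trans _ _ (\int[mu]_(x in D) (g x + d)%:E + (e / 2)%:E)); last first.
    under eq_integral do rewrite EFinD.
    rewrite ge0_integralD//; last first.
    - by move=> x _; rewrite lee_fin ltW.
    - by apply/measurable_EFinP.
    have -> : \int[mu]_(_ in D) d%:E = (d * l)%:E.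
      by rewrite integral_cst// EFinM -lE.
    rewrite -addeA leeD2l// -EFinD lee_fin.
    by rewrite [leRHS]splitr lerD2r.
  rewrite leeD2r// ge0_le_integral//.
  - by move=> x _; apply: nneseries_ge0.
  - apply: measurable_funTS.
    by apply: ge0_emeasurable_sum => [//|n _]; exact: mi.
  - by apply/measurable_EFinP; apply: measurable_funD.
  move=> x Dx; pose n := Num.truncn (g x / d).
  have xn k : E k x -> k = n.
    move=> -[_ /=]; rewrite in_itv/= !(mulrC d) -ler_pdivlMr// -ltr_pdivrMr//.
    by move=> h; apply/esym/truncn_def.
  rewrite (@nneseriesD1 _ _ n)//; rewrite eseries0 ?adde0.
    rewrite /w -EFinM lee_fin indicE.
    case: (boolP (x \in E n)) => [/set_mem[_ /=]|_]; last first.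
      by rewrite mulr0 addr_ge0 ?g0// ltW.
    rewrite in_itv/= mulr1 => /andP[+ _].
    by rewrite -natr1 mulrDr mulr1 lerD2r.
  move=> k _ /= kn; rewrite indicE memNset ?mule0// => /xn kE.
  by rewrite kE eqxx in kn.
Qed.

(** Let u be a majorant of g as above. The set of the x with
    |f x - f a| <= \int_a^x u is stable under suprema because f is continuous and
    the right-hand side is monotone, and it extends to the right of each of its
    points x < b because u exceeds g x on a neighbourhood of x; so it
    reaches b. *)
Lemma dini_le_integral (a b : R) (f : R -> R) (g : measurableTypeR R -> R) : (a <= b)%R ->
  measurable_fun `[a, b] g -> (forall x, x \in `[a, b] -> (0 <= g x)%R) ->
  {within `[a, b], continuous f} ->
  (forall x, x \in `[a, b[ -> forall e, (0 < e)%R ->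
     \forall y \near x^'+, (`|f y - f x| <= (g x + e) * (y - x))%R) ->
  `|f b - f a|%:E <= \int[mu]_(x in `[a, b]) (g x)%:E.
Proof.
move=> ab mg g0 cf dini; apply/lee_addgt0Pr => e e0.
have muab : mu `[a, b]%classic < +oo.
  by rewrite /mu lebesgue_measure_itv/=; case: ifPn => // _; rewrite -EFinB ltry.
have [u [mu_u u0 ug ule]] := lsc_majorant e0 (measurable_itv `[a, b]) muab mg g0.
apply: le_trans ule.
pose H x := \int[mu]_(t in `[a, x[) u t.
have H0 x : 0 <= H x by exact: integral_ge0.
have Hle x y : (x <= y)%R -> H x <= H y.
  move=> xy; apply: ge0_subset_integral => //; first exact: measurable_funTS.
  by apply: subset_itvl; rewrite bnd_simp.
suff : `|f b - f a|%:E <= H b.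
  move=> /le_trans; apply; apply: ge0_subset_integral => //.
    exact: measurable_funTS.
  by apply: subset_itvl; rewrite bnd_simp.
pose S := [set x | x \in `[a, b] /\ `|f x - f a|%:E <= H x].
have Sa : S a by split; [rewrite in_itv/= lexx ab|rewrite subrr normr0].
have hS : has_sup S.
  by split; [exists a|exists b => x [+ _]; rewrite in_itv/= => /andP[]].
pose s := sup S.
have as_ : (a <= s)%R by exact: sup_ubound hS.2 _ Sa.
have sb : (s <= b)%R.
  by apply: sup_le_ub; [exists a|move=> x [+ _]; rewrite in_itv/= => /andP[]].
have abs : s \in `[a, b] by rewrite in_itv/= as_ sb.
have Ss : S s.
  split => //; apply/lee_addgt0Pr => k k0.
  have : \forall t \near within `[a, b] (nbhs s), (`|f s - f t| < k)%R.
    have /cvgrPdist_lt : f x @[x --> within `[a, b] (nbhs s)] --> f s.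
      by move/subspace_continuousP : cf; apply.
    by apply.
  rewrite near_withinE => /nbhs_ballP[t /= t0 Ht].
  have [x [xab xS] sx] := sup_adherent t0 hS.
  have xs : (x <= s)%R by apply: sup_ubound => //; case: hS.
  have fsx : (`|f s - f x| < k)%R.
    by apply: Ht => //; rewrite /ball/= ger0_norm ?subr_ge0// ltrBlDl -ltrBlDr.
  have -> : (f s - f a = (f s - f x) + (f x - f a))%R by rewrite addrA subrK.
  apply: (@le_trans _ _ (`|f s - f x|%:E + `|f x - f a|%:E)).
    by rewrite -EFinD lee_fin ler_normD.
  rewrite addeC leeD//; last by rewrite lee_fin ltW.
  exact: le_trans xS (Hle _ _ xs).
have [sltb|bs] := ltP s b; last first.
  have -> : b = s by apply/eqP; rewrite eq_le sb bs.
  by case: Ss.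
exfalso.
have [r [U [gr oU Us Ur]]] := ug s abs.
have rg : (0 < r - g s)%R by rewrite subr_gt0.
have sab : s \in `[a, b[ by rewrite in_itv/= as_ sltb.
have [t /= t0 tU] : \forall y \near s, U y.
  exact: open_nbhs_nbhs.
near s^'+ => y.
have sy : (s < y)%R by near: y; exact: nbhs_right_gt.
have yb : (y < b)%R by near: y; exact: nbhs_right_lt.
have yt : (y < s + t)%R by near: y; apply: nbhs_right_lt; rewrite ltrDl.
have fys : (`|f y - f s| <= r * (y - s))%R.
  have -> : r = (g s + (r - g s))%R by rewrite addrCA subrr addr0.
  by near: y; exact: dini.
suff : S y by move=> Sy; have := sup_ubound hS.2 Sy; rewrite leNgt sy.
split; first by rewrite in_itv/= (le_trans as_ (ltW sy)) (ltW yb).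
have -> : (f y - f a = (f y - f s) + (f s - f a))%R by rewrite addrA subrK.
apply: (@le_trans _ _ (`|f y - f s|%:E + `|f s - f a|%:E)).
  by rewrite -EFinD lee_fin ler_normD.
(* On [s, y[ the majorant is at least r, which bounds the increment of f. *)
have -> : H y = H s + \int[mu]_(x in `[s, y[) u x.
  rewrite /H -ge0_integral_setU//.
  - congr (integral _ _ _); by rewrite -itv_bndbnd_setU// bnd_simp// ltW.
  - exact: measurable_funTS.
  - apply/disj_setPS => x [] /=; rewrite !in_itv/= => /andP[_ xs] /andP[sx _].
    by have := le_lt_trans sx xs; rewrite ltxx.
have [_ Ssle] := Ss; rewrite [leLHS]addeC; apply: (leeD Ssle).
apply: (@le_trans _ _ (\int[mu]_(x in `[s, y[) r%:E)).
  rewrite integral_cst//= lebesgue_measure_itv/= lte_fin sy -EFinB -EFinM.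
  by rewrite lee_fin.
apply: ge0_le_integral => //.
- by move=> x _; rewrite lee_fin (le_trans _ (ltW gr))// g0.
- exact: measurable_funTS.
- move=> x /=; rewrite in_itv/= => /andP[sx xy]; apply: Ur; apply: tU => /=.
  by rewrite ler0_norm ?subr_le0// opprB ltrBlDl (lt_trans xy).
Unshelve. all: by end_near. Qed.

End derivative_bound.

(** * Integration over the first coordinate *)

Section tonelli_rV.
Context {R : realType}.
Let mu := @lebesgue_measure R.

Lemma row_rV_cons n p : \row_i @rV_cons R n p ord0 (lift ord0 i) = p.2.
Proof. by apply/rowP => i; rewrite mxE rV_consS. Qed.

Section slices.
Context n (A : set (measurableTypeR R)) (B : set 'rV[R]_n).
Hypotheses (mA : measurable A) (mB : measurable B).
Variable G : 'rV[R]_n.+1 -> \bar R.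
Hypotheses (mG : measurable_fun setT G) (G0 : forall v, 0 <= G v).

Let D := [set v : 'rV[R]_n.+1 |
  A (v ord0 ord0) /\ B (\row_i v ord0 (lift ord0 i))].

Let preD : @rV_cons R n @^-1` D = A `*` B.
Proof.
by apply/seteqP; split => p /=; rewrite /D/= row_rV_cons rV_cons0.
Qed.

Let mcons : measurable_fun setT (G \o @rV_cons R n).
Proof. exact: measurableT_comp mG (@measurable_rV_cons _ n). Qed.

Let H : measurableTypeR R * 'rV[R]_n -> \bar R := (G \o @rV_cons R n) \_ (A `*` B).

Let mH : measurable_fun setT H.
Proof.
apply/(measurable_restrictT _ _).1; first exact: measurableX.
exact: measurable_funTS.
Qed.

Let H0 p : 0 <= H p.
Proof. by rewrite /H patchE; case: ifP => // _; exact: G0. Qed.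

Let mD : measurable D.
Proof.
have mrow : measurable_fun setT (fun v : 'rV[R]_n.+1 => \row_i v ord0 (lift ord0 i)).
  by apply: measurable_fun_rVP => i; under eq_fun do rewrite mxE;
    exact: measurable_rV_coord.
apply: measurableI; rewrite -[X in measurable X]setTI.
  exact: (@measurable_rV_coord _ (measurableTypeR R)).
exact: mrow.
Qed.

Let integral_prod :
  \int[lebesgue_rV n.+1]_(v in D) G v = \int[mu \x lebesgue_rV n]_p H p.
Proof.
rewrite [LHS](@ge0_integral_pushforward _ _ _ _ _ _ (@measurable_rV_cons R n)
  (mu \x lebesgue_rV n) D G)//; last exact: measurable_funTS.
by rewrite preD integral_mkcond.
Qed.

(** Tonelli's theorem for the recursively defined Lebesgue measure, over a
    product of a set of first coordinates and a set of tails, in both orders of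
    integration. *)
Lemma ge0_integral_rV_cons : \int[lebesgue_rV n.+1]_(v in D) G v =
  \int[mu]_(t in A) \int[lebesgue_rV n]_(v in B) G (rV_cons (t, v)).
Proof.
rewrite integral_prod fubini_tonelli1// [RHS]integral_mkcond.
apply: eq_integral => t _; rewrite /fubini_F patchE.
rewrite [in RHS]integral_mkcond.
case: ifPn => tA.
  apply: eq_integral => v _; rewrite /H !patchE.
  by rewrite in_setX tA.
under eq_integral do rewrite /H patchE in_setX (negbTE tA)/=.
exact: integral0.
Qed.

Lemma ge0_integral_rV_consC : \int[lebesgue_rV n.+1]_(v in D) G v =
  \int[lebesgue_rV n]_(v in B) \int[mu]_(t in A) G (rV_cons (t, v)).
Proof.
rewrite integral_prod fubini_tonelli2// [RHS]integral_mkcond.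
apply: eq_integral => v _; rewrite /fubini_G patchE.
rewrite [in RHS]integral_mkcond.
case: ifPn => vB.
  apply: eq_integral => t _; rewrite /H !patchE.
  by rewrite in_setX vB andbT.
under eq_integral do rewrite /H patchE in_setX (negbTE vB) andbF/=.
exact: integral0.
Qed.

Lemma measurable_integral_rV_cons :
  measurable_fun A (fun t => \int[lebesgue_rV n]_(v in B) G (rV_cons (t, v))).
Proof.
have mF := measurable_fun_fubini_tonelli_F (m2 := lebesgue_rV n) _ mH H0.
apply: eq_measurable_fun (measurable_funTS mF) => t tA.
rewrite /fubini_F [RHS]integral_mkcond.
by apply: eq_integral => v _; rewrite /H !patchE in_setX tA.
Qed.

Lemma measurable_integral_rV_consC :
  measurable_fun B (fun v => \int[mu]_(t in A) G (rV_cons (t, v))).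
Proof.
have mF := measurable_fun_fubini_tonelli_G (m1 := mu) _ mH H0.
apply: eq_measurable_fun (measurable_funTS mF) => v vB.
rewrite /fubini_G [RHS]integral_mkcond.
by apply: eq_integral => t _; rewrite /H !patchE in_setX vB andbT.
Qed.

End slices.
End tonelli_rV.

(** * Comparison of the integrals over two cubes *)

Section half_open_cubes.
Context {R : realType}.
Local Notation mu := (@lebesgue_measure R).

(** Half-open edges make adjacent grid cells disjoint. *)
Definition hcube n (a : 'I_n -> R) (s : R) : set 'rV[R]_n :=
  [set v | forall i, v ord0 i \in `[a i, (a i + s)%R[].

Definition row_upd n (v : 'rV[R]_n) (j : 'I_n) (t : R) : 'rV[R]_n :=
  \row_i if i == j then t else v ord0 i.

Lemma measurable_hcube n (a : 'I_n -> R) s : measurable (hcube a s).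
Proof.
exact: (@measurable_rV_box _ (measurableTypeR R) n
  (fun i => `[a i, (a i + s)%R[%classic)).
Qed.

Lemma lebesgue_itv_side (x s : R) : (0 <= s)%R ->
  mu `[x, (x + s)%R[%classic = s%:E.
Proof.
move=> s0; rewrite lebesgue_measure_itv/= lte_fin ltrDl.
case: ltgtP s0 => // [s0 _|<- _//].
by rewrite -EFinB addrAC subrr add0r.
Qed.

Lemma lebesgue_hcube n (a : 'I_n -> R) s : (0 <= s)%R ->
  lebesgue_rV n (hcube a s) = (s ^+ n)%:E.
Proof.
move=> s0.
rewrite [LHS](@lebesgue_rV_box R n (fun i => `[a i, (a i + s)%R[%classic))//.
under eq_bigr do rewrite lebesgue_itv_side//.
elim: n {a} => [|n IHn]; first by rewrite big_ord0.
by rewrite big_ord_recl IHn exprS EFinM.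
Qed.

Lemma sub_hcube n (a k : 'I_n -> R) p w :
  (forall i, k i <= a i /\ a i + p <= k i + w)%R -> hcube a p `<=` hcube k w.
Proof.
move=> ak v av i; have [h1 h2] := ak i; have := av i; rewrite !in_itv/=.
by move=> /andP[v1 v2]; rewrite (le_trans h1)//= (lt_le_trans v2).
Qed.

Lemma hcubeS n (a : 'I_n.+1 -> R) s : hcube a s =
  [set v | `[a ord0, (a ord0 + s)%R[%classic (v ord0 ord0) /\
    hcube (fun i => a (lift ord0 i)) s (\row_i v ord0 (lift ord0 i))].
Proof.
apply/seteqP; split => v /=.
  by move=> av; split => // i; rewrite mxE.
move=> [v0 av] i; case: (unliftP ord0 i) => [j|] ->//.
by have := av j; rewrite mxE.
Qed.

Lemma row_upd_cons0 n (t s : R) (v : 'rV[R]_n) :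
  row_upd (rV_cons (t, v)) ord0 s = rV_cons (s, v).
Proof.
apply/rowP => i; rewrite mxE; case: (unliftP ord0 i) => [j|] ->.
  by rewrite !rV_consS.
by rewrite eqxx !rV_cons0.
Qed.

Lemma row_upd_consS n (t s : R) (v : 'rV[R]_n) j :
  row_upd (rV_cons (t, v)) (lift ord0 j) s = rV_cons (t, row_upd v j s).
Proof.
apply/rowP => i; rewrite mxE; case: (unliftP ord0 i) => [l|] ->.
  by rewrite !rV_consS mxE (inj_eq lift_inj).
by rewrite (negbTE (neq_lift _ _)) !rV_cons0.
Qed.

Lemma hcube_cons n (a : 'I_n.+1 -> R) s t v :
  hcube a s (rV_cons (t, v)) <->
  (t \in `[a ord0, (a ord0 + s)%R[) /\ hcube (fun i => a (lift ord0 i)) s v.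
Proof.
split.
  move=> h; split; first by have := h ord0; rewrite rV_cons0.
  by move=> i; have := h (lift ord0 i); rewrite rV_consS.
move=> [t0 h] i; case: (unliftP ord0 i) => [j|] ->; first by rewrite rV_consS.
by rewrite rV_cons0.
Qed.

Lemma measurable_rV_cons_slice n (F : 'rV[R]_n.+1 -> \bar R) t :
  measurable_fun setT F -> measurable_fun setT (fun v => F (rV_cons (t, v))).
Proof.
move=> mF; apply: (measurableT_comp mF).
apply: (measurableT_comp (@measurable_rV_cons R n)).
exact: measurable_pair1.
Qed.

(** The arithmetic of the induction step of [hcube_compare]: X and Y are the
    integrals over two boxes with the same tail of side p and first edges of
    lengths p and q, and Z is the integral over the cube of side q. *)
Lemma hcube_compare_step n (p q w : R) (X Y Z K : \bar R) :
  (0 <= p)%R -> (0 <= q)%R -> (p <= w)%R -> (q <= w)%R ->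
  0 <= Y -> 0 <= Z -> 0 <= K ->
  q%:E * X <= p%:E * (Y + q%:E * K) ->
  (q ^+ n)%:E * Y <= (p ^+ n)%:E * Z + (n%:R * (p * q * w ^+ n.-1))%:E * K ->
  (q ^+ n.+1)%:E * X <=
  (p ^+ n.+1)%:E * Z + (n.+1%:R * (p * q * w ^+ n))%:E * K.
Proof.
move=> p0 q0 pw qw Y0 Z0 K0 S3 S4.
have w0 : (0 <= w)%R by exact: le_trans pw.
have qn0 : (0 <= q ^+ n)%R by rewrite exprn_ge0.
have pn0 : (0 <= p ^+ n)%R by rewrite exprn_ge0.
move: S4; set c := (n%:R * _)%R => S4.
have c0 : (0 <= c)%R by rewrite !mulr_ge0// exprn_ge0.
have ccE : (p * c + p * (q ^+ n * q) <= n.+1%:R * (p * q * w ^+ n))%R.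
  rewrite -natr1 mulrDl mul1r lerD//.
    rewrite /c; case: (n) => [|m]; first by rewrite !mul0r mulr0.
    rewrite /= exprS mulrCA ler_wpM2l//.
    have -> : (p * (p * q * w ^+ m) = p * q * (p * w ^+ m))%R by ring.
    by rewrite ler_wpM2l ?mulr_ge0// ler_wpM2r ?exprn_ge0.
  rewrite -mulrA ler_wpM2l// mulrC ler_wpM2l// lerXn2r//.
rewrite exprSr EFinM -muleA.
apply: (@le_trans _ _ ((q ^+ n)%:E * (p%:E * (Y + q%:E * K)))).
  by rewrite lee_wpmul2l.
rewrite muleCA ge0_muleDr ?mule_ge0// [_ * (_%:E * K)]muleA -EFinM.
apply: (@le_trans _ _ (p%:E * ((p ^+ n)%:E * Z + c%:E * K + (q ^+ n * q)%:E * K))).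
  by rewrite lee_wpmul2l// leeD2r.
have h1 : 0 <= c%:E * K by rewrite mule_ge0.
have h2 : 0 <= (q ^+ n * q)%:E * K by rewrite mule_ge0// lee_fin mulr_ge0.
have h3 : 0 <= (p ^+ n)%:E * Z by rewrite mule_ge0.
rewrite !ge0_muleDr ?adde_ge0// !muleA -!EFinM -exprS -addeA leeD2l//.
have pc0 : (0 <= p * c)%R by rewrite mulr_ge0.
have pq0 : (0 <= p * (q ^+ n * q))%R by rewrite !mulr_ge0.
have <- : (p * c + p * (q ^+ n * q))%:E * K =
    (p * c)%:E * K + (p * (q ^+ n * q))%:E * K.
  by rewrite EFinD ge0_muleDl.
by rewrite lee_wpmul2r.
Qed.

(** Multiplied by the volumes, the means of F over the cubes of sides p and q
    differ by at most n p q w^(n-1) \int G. The first edge is exchanged by means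
    of the hypothesis on lines, then the tail by induction on the slices.
    Everything is nonnegative, so that Tonelli's theorem applies with no
    integrability assumption, and the one-sided bound obtained yields the
    two-sided one by exchanging the roles of the cubes. *)
Lemma hcube_compare n (a b k : 'I_n -> R) (p q w : R)
    (F G : 'rV[R]_n -> \bar R) :
  (0 <= p)%R -> (0 <= q)%R -> (p <= w)%R -> (q <= w)%R ->
  (forall i, k i <= a i /\ a i + p <= k i + w)%R ->
  (forall i, k i <= b i /\ b i + q <= k i + w)%R ->
  measurable_fun setT F -> measurable_fun setT G ->
  (forall v, 0 <= F v) -> (forall v, 0 <= G v) ->
  (forall v j s, hcube k w v -> s \in `[k j, (k j + w)%R[ ->
     F (row_upd v j s) <=
     F v + \int[mu]_(t in `[k j, (k j + w)%R[) G (row_upd v j t)) ->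
  (q ^+ n)%:E * \int[lebesgue_rV n]_(v in hcube a p) F v <=
  (p ^+ n)%:E * \int[lebesgue_rV n]_(v in hcube b q) F v +
  (n%:R * (p * q * w ^+ n.-1))%:E * \int[lebesgue_rV n]_(v in hcube k w) G v.
Proof.
move=> p0 q0 pw qw; elim: n a b k F G => [|n IHn] a b k F G ak bk mF mG F0 G0 FG.
  rewrite mul0r mul0e adde0 !expr0 !mul1e.
  have -> : hcube a p = hcube b q by apply/seteqP; split => v _ [].
  by [].
set a' := fun i => a (lift ord0 i); set b' := fun i => b (lift ord0 i).
set k' := fun i => k (lift ord0 i).
pose I0 := `[a ord0, (a ord0 + p)%R[%classic.
pose J0 := `[b ord0, (b ord0 + q)%R[%classic.
pose K0 := `[k ord0, (k ord0 + w)%R[%classic.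
have IK : I0 `<=` K0.
  by move=> t; have [? ?] := ak ord0; rewrite /I0/K0/= !in_itv/=; lra.
have JK : J0 `<=` K0.
  by move=> t; have [? ?] := bk ord0; rewrite /J0/K0/= !in_itv/=; lra.
pose A t := \int[lebesgue_rV n]_(v in hcube a' p) F (rV_cons (t, v)).
pose B t := \int[lebesgue_rV n]_(v in hcube b' q) F (rV_cons (t, v)).
pose C t := \int[lebesgue_rV n]_(v in hcube k' w) G (rV_cons (t, v)).
have A0 t : 0 <= A t by apply: integral_ge0.
have B0 t : 0 <= B t by apply: integral_ge0.
have C0 t : 0 <= C t by apply: integral_ge0.
have mI : measurable (I0 : set (measurableTypeR R)) by exact: measurable_itv.
have mJ : measurable (J0 : set (measurableTypeR R)) by exact: measurable_itv.
have mK : measurable (K0 : set (measurableTypeR R)) by exact: measurable_itv.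
have msl (H : 'rV[R]_n.+1 -> \bar R) (D : set (measurableTypeR R)) c r :
    measurable_fun setT H -> (forall v, 0 <= H v) -> measurable D ->
    measurable_fun D (fun t => \int[lebesgue_rV n]_(v in hcube c r) H (rV_cons (t, v))).
  by move=> mH H0 mD; apply: measurable_integral_rV_cons => //; exact: measurable_hcube.
set K := \int[lebesgue_rV n.+1]_(v in hcube k w) G v.
have K0' : 0 <= K by exact: integral_ge0.
have KE : K = \int[mu]_(t in K0) C t.
  by rewrite /K hcubeS ge0_integral_rV_cons//; exact: measurable_hcube.
have KE' : K = \int[lebesgue_rV n]_(v in hcube k' w) \int[mu]_(t in K0) G (rV_cons (t, v)).
  by rewrite /K hcubeS ge0_integral_rV_consC//; exact: measurable_hcube.
have ak' i : (k' i <= a' i /\ a' i + p <= k' i + w)%R by exact: ak.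
have bk' i : (k' i <= b' i /\ b' i + q <= k' i + w)%R by exact: bk.
(* The slice integrals of F have oscillation at most K along the first edge. *)
have S1 s t : K0 s -> K0 t -> A s <= A t + K.
  move=> Ks Kt.
  have mGint : measurable_fun (hcube k' w) (fun v => \int[mu]_(t in K0) G (rV_cons (t, v))).
    by apply: measurable_integral_rV_consC => //; exact: measurable_hcube.
  have mGint' := measurable_funS (measurable_hcube k' w) (sub_hcube ak') mGint.
  have mFt u := measurable_funTS (measurable_rV_cons_slice u mF).
  apply: (@le_trans _ _ (\int[lebesgue_rV n]_(v in hcube a' p)
      (F (rV_cons (t, v)) + \int[mu]_(t in K0) G (rV_cons (t, v))))).
    apply: ge0_le_integral => //; first exact: measurable_hcube.
    - by apply: emeasurable_funD => //; exact: measurable_hcube.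
    - move=> v av.
      have kv : hcube k w (rV_cons (t, v)).
        by apply/hcube_cons; split => //; apply: sub_hcube av.
      have := FG _ ord0 s kv Ks; rewrite row_upd_cons0 => /le_trans; apply.
      by under eq_integral do rewrite row_upd_cons0.
  rewrite ge0_integralD//; last 2 first.
    exact: measurable_hcube.
    by move=> v _; exact: integral_ge0.
  rewrite leeD2l// KE'; apply: ge0_subset_integral => //.
  - exact: measurable_hcube.
  - exact: measurable_hcube.
  - by move=> v _; exact: integral_ge0.
  - exact: sub_hcube.
have mA (D : set (measurableTypeR R)) : measurable D -> measurable_fun D A.
  by move=> mD; exact: msl.
have mB (D : set (measurableTypeR R)) : measurable D -> measurable_fun D B.
  by move=> mD; exact: msl.
have mC (D : set (measurableTypeR R)) : measurable D -> measurable_fun D C.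
  by move=> mD; exact: msl.
have muI : mu I0 = p%:E by exact: lebesgue_itv_side.
have muJ : mu J0 = q%:E by exact: lebesgue_itv_side.
(* Averaging over t, then over s, exchanges the first edge. *)
have S2 s : K0 s -> q%:E * A s <= \int[mu]_(t in J0) A t + q%:E * K.
  move=> Ks; have -> : q%:E * A s = \int[mu]_(t in J0) A s.
    by rewrite integral_cst// muleC -muJ.
  have -> : q%:E * K = \int[mu]_(t in J0) K.
    by rewrite integral_cst// muleC -muJ.
  rewrite -ge0_integralD//; last exact: mA.
  apply: ge0_le_integral => //.
  - by apply: emeasurable_funD => //; exact: mA.
  - by move=> t Jt; apply: S1 => //; exact: JK.
have S3 : q%:E * \int[mu]_(t in I0) A t <=
    p%:E * (\int[mu]_(t in J0) A t + q%:E * K).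
  rewrite -ge0_integralZl_EFin//; last exact: mA.
  have -> : p%:E * (\int[mu]_(t in J0) A t + q%:E * K) =
      \int[mu]_(t in I0) (\int[mu]_(t in J0) A t + q%:E * K).
    by rewrite integral_cst// muleC -muI.
  apply: ge0_le_integral => //.
  - by move=> t _; rewrite mule_ge0.
  - by apply: measurable_funeM; exact: mA.
  - by move=> t It; apply: S2; exact: IK.
pose c : R := (n%:R * (p * q * w ^+ n.-1))%R.
have w0 : (0 <= w)%R by exact: le_trans pw.
have c0 : (0 <= c)%R by rewrite !mulr_ge0// exprn_ge0.
(* The induction hypothesis, integrated over the new first edge. *)
have S4 : (q ^+ n)%:E * \int[mu]_(t in J0) A t <=
    (p ^+ n)%:E * \int[mu]_(t in J0) B t + c%:E * K.
  have qn0 : (0 <= q ^+ n)%R by rewrite exprn_ge0.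
  have pn0 : (0 <= p ^+ n)%R by rewrite exprn_ge0.
  rewrite -ge0_integralZl_EFin//; last exact: mA.
  apply: (@le_trans _ _ (\int[mu]_(t in J0) ((p ^+ n)%:E * B t + c%:E * C t))).
    apply: ge0_le_integral => //.
    - by move=> t _; rewrite mule_ge0.
    - by apply: measurable_funeM; exact: mA.
    - by apply: emeasurable_funD; apply: measurable_funeM; [exact: mB|exact: mC].
    - move=> t Jt; apply: IHn => //.
      + exact: measurable_rV_cons_slice.
      + exact: measurable_rV_cons_slice.
      + move=> v j s kv sj.
        have kv' : hcube k w (rV_cons (t, v)).
          by apply/hcube_cons; split => //; exact: JK.
        have := FG _ (lift ord0 j) s kv' sj.
        rewrite row_upd_consS => /le_trans; apply.
        by under eq_integral do rewrite row_upd_consS.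
  rewrite ge0_integralD//; last 4 first.
  - by move=> t _; rewrite mule_ge0.
  - by apply: measurable_funeM; exact: mB.
  - by move=> t _; rewrite mule_ge0.
  - by apply: measurable_funeM; exact: mC.
  rewrite !ge0_integralZl_EFin//; [|exact: mC|exact: mB].
  rewrite leeD2l// lee_wpmul2l// KE; apply: ge0_subset_integral => //; exact: mC.
have -> : \int[lebesgue_rV n.+1]_(v in hcube a p) F v = \int[mu]_(t in I0) A t.
  by rewrite hcubeS ge0_integral_rV_cons//; exact: measurable_hcube.
have -> : \int[lebesgue_rV n.+1]_(v in hcube b q) F v = \int[mu]_(t in J0) B t.
  by rewrite hcubeS ge0_integral_rV_cons//; exact: measurable_hcube.
apply: hcube_compare_step S3 S4 => //.
  by apply: integral_ge0 => t _; exact: A0.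
by apply: integral_ge0 => t _; exact: B0.
Qed.
End half_open_cubes.

(** * Differentiable functions on the closed unit cube *)

Section functions_on_the_cube.
Local Close Scope ereal_scope.
Context {R : realType} (d : nat).
Implicit Types (f : 'rV[R]_d -> R) (x y v : 'rV[R]_d) (j : 'I_d).
Local Notation cube := (@unit_cube R d).

Lemma row_updB v j t : row_upd v j t - v = (t - v ord0 j) *: delta_mx ord0 j.
Proof.
apply/rowP => i; rewrite !mxE eqxx/=; case: eqP => [->|_].
  by rewrite mulr1.
by rewrite subrr mulr0.
Qed.

Lemma row_upd_id v j : row_upd v j (v ord0 j) = v.
Proof. by apply/rowP => i; rewrite mxE; case: eqP => // ->. Qed.

Lemma row_updE v j t : row_upd v j t ord0 j = t.
Proof. by rewrite mxE eqxx. Qed.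

Lemma row_upd_upd v j s t : row_upd (row_upd v j s) j t = row_upd v j t.
Proof. by apply/rowP => i; rewrite !mxE; case: eqP. Qed.

Lemma norm_rV_le v (e : R) : (0 <= e)%R ->
  (forall i, `|v ord0 i| <= e)%R -> (`|v| <= e)%R.
Proof.
move=> e0 ve; rewrite [leLHS]/Num.Def.normr/= mx_normrE bigmax_le//= => -[i l] _.
by rewrite (ord1 i).
Qed.

Lemma norm_row_updB v j t : (`|row_upd v j t - v| <= `|t - v ord0 j|)%R.
Proof.
apply: norm_rV_le => // i; rewrite !mxE; case: eqP => [->//|_].
by rewrite subrr normr0.
Qed.

Lemma unit_cube_upd v j t : cube v -> t \in `[0%R, 1%R] -> cube (row_upd v j t).
Proof. by move=> cv ct i; rewrite mxE; case: ifP. Qed.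

Lemma measurable_unit_cube : measurable cube.
Proof.
exact: (@measurable_rV_box _ (measurableTypeR R) d (fun=> `[0%R, 1%R]%classic)).
Qed.

Lemma within_cube_dist f x e : {within cube, continuous f} -> cube x ->
  (0 < e)%R -> exists2 r, (0 < r)%R &
    forall y, cube y -> (`|y - x| < r)%R -> (`|f y - f x| < e)%R.
Proof.
move=> /subspace_continuousP cf cx e0.
have /cvgrPdist_lt/(_ e e0) := cf x cx.
rewrite near_withinE => /nbhs_normP[r /= r0 rP]; exists r => // y cy yx.
by rewrite distrC; apply: rP => //=; rewrite /ball_/= distrC.
Qed.

Lemma cube_differentiable_dist f x e : cube_differentiable f -> cube x ->
  (0 < e)%R -> exists2 r, (0 < r)%R &
    forall y, cube y -> (`|y - x| < r)%R ->
      (`|f y - f x - 'd f (within cube (nbhs x)) (y - x)| <= e * `|y - x|)%R.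
Proof.
move=> df cx e0.
have /diffP[_ /funext/(eqaddoP _ _ _ _).1/(_ e e0)] := df x cx.
rewrite /= (lim_within_cube cx) near_withinE => /nbhs_normP[r /= r0 rP].
exists r => // y cy yx.
have := rP y; rewrite /ball_/= distrC => /(_ yx cy).
by rewrite !fctE/= opprD addrA.
Qed.

Lemma cube_differentiable_continuous f :
  cube_differentiable f -> {within cube, continuous f}.
Proof.
move=> df; apply/subspace_continuousP => x cx.
have /diffP[dc _] := df x cx.
apply/cvgrPdist_lt => e e0.
have e20 : (0 < e / 2)%R by rewrite divr_gt0.
have [r r0 rP] := cube_differentiable_dist df cx ltr01.
have /cvgrPdist_lt/(_ _ e20)/nbhs_normP[s /= s0 sP] := dc 0%R.
rewrite near_withinE nearE; apply/nbhs_ballP.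
exists (Num.min (Num.min r s) (e / 2)) => /=.
  by rewrite !lt_min r0 s0.
move=> y /=; rewrite -ball_normE/= !lt_min => /andP[/andP[yr ys] ye] cy.
have := rP y cy; rewrite mul1r distrC => /(_ yr) h1.
have := sP (y - x); rewrite /ball_/= sub0r normrN distrC => /(_ ys).
rewrite linear0 sub0r normrN => h2.
rewrite distrC -[(f y - f x)%R](subrK ('d f (within cube (nbhs x)) (y - x))).
apply: le_lt_trans (ler_normD _ _) _; rewrite [ltRHS]splitr ler_ltD//.
by rewrite (le_trans h1)// ltW.
Qed.

(** First-order expansion along an edge direction. It holds at the boundary too,
    as the other coordinates are unchanged and the moving one stays in the
    interval [0, 1]. *)
Lemma cube_partial_dist f x j e : cube_differentiable f -> cube x ->
  (0 < e)%R -> exists2 r, (0 < r)%R &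
    forall t, t \in `[0%R, 1%R] -> (`|t - x ord0 j| < r)%R ->
      (`|f (row_upd x j t) - f x - cube_gradient f x ord0 j * (t - x ord0 j)|
        <= e * `|t - x ord0 j|)%R.
Proof.
move=> df cx e0; have [r r0 rP] := cube_differentiable_dist df cx e0.
exists r => // t t01 tr.
have := rP (row_upd x j t) (unit_cube_upd j cx t01).
move=> /(_ (le_lt_trans (norm_row_updB _ _ _) tr)).
have -> : 'd f (within cube (nbhs x)) (row_upd x j t - x) =
    cube_gradient f x ord0 j * (t - x ord0 j).
  by rewrite row_updB linearZ/= /cube_gradient mxE mulrC.
move=> /le_trans; apply.
by rewrite ler_wpM2l ?(ltW e0)// norm_row_updB.
Qed.

Lemma normr_coord_le_euclidean v j : (`|v ord0 j| <= euclidean_norm v)%R.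
Proof.
rewrite -sqrtr_sqr /euclidean_norm ler_wsqrtr// (bigD1 j)//= lerDl.
by apply: sumr_ge0 => i _; exact: sqr_ge0.
Qed.

Lemma within_cube_bounded f : {within cube, continuous f} ->
  exists2 B : R, (0 <= B)%R & forall x, cube x -> (`|f x| <= B)%R.
Proof.
move=> cf.
have /compact_bounded[M [_ MP]] : compact (f @` cube).
  apply: continuous_compact => //.
  exact: (@rV_compact R d (fun=> `[0%R, 1%R]%classic) (fun=> @segment_compact _ _ _)).
exists (`|M| + 1)%R => [|x cx]; first by rewrite addr_ge0.
by apply: MP; [rewrite (le_lt_trans (ler_norm M))// ltrDl|exists x].
Qed.

End functions_on_the_cube.

(** * Measurability of the function and of its gradient *)

Section measurability.
Context {R : realType} (d : nat).
Implicit Types (f : 'rV[R]_d -> R) (x y v : 'rV[R]_d) (j : 'I_d).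
Local Notation cube := (@unit_cube R d).
Local Close Scope ereal_scope.

Lemma mem_grid_itv (k i : nat) (t : R) : (0 < k)%N -> 0 <= t ->
  (t \in `[i%:R / k%:R, (i%:R / k%:R + k%:R^-1)[) = (Num.truncn (t * k%:R) == i).
Proof.
move=> k0 t0; have kR : 0 < k%:R :> R by rewrite ltr0n.
rewrite in_itv/= truncn_eq ?mulr_ge0// -[X in _ + X]mul1r -mulrDl natr1.
by rewrite ler_pdivrMr// ltr_pdivlMr.
Qed.

(** The function is the pointwise limit of step functions that take its values at
    the lower corners of a grid; on the closed cube these corners stay in the
    cube. This links the topology of row vectors, through which continuity
    is defined, with the sigma-algebra generated by the coordinates. *)
Lemma measurable_cube_continuous f :
  {within cube, continuous f} -> measurable_fun cube f.
Proof.
move=> cf.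
(* A coordinate equal to 1 has index k+1 on a grid of mesh 1/(k+1), so k+2
   indices are required. *)
pose node k (i : {ffun 'I_d -> 'I_k.+2}) : 'rV[R]_d :=
  \row_j ((i j)%:R / k.+1%:R).
pose cell k (i : {ffun 'I_d -> 'I_k.+2}) : set 'rV[R]_d :=
  hcube (fun j => (i j)%:R / k.+1%:R) k.+1%:R^-1.
pose idx k x : {ffun 'I_d -> 'I_k.+2} :=
  [ffun j => inord (Num.truncn (x ord0 j * k.+1%:R))].
pose h k x := \sum_i f (node k i) * \1_(cell k i) x.
have idxE k x j : cube x -> idx k x j = Num.truncn (x ord0 j * k.+1%:R) :> nat.
  move=> /(_ j); rewrite in_itv/= => /andP[x0 x1].
  rewrite ffunE inordK// ltnS -(ler_nat R).
  apply: (@le_trans _ _ (x ord0 j * k.+1%:R)).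
    by rewrite truncn_le mulr_ge0.
  by rewrite ler_piMl.
have cellE k i x : cube x -> cell k i x <-> i = idx k x.
  move=> cx; split=> [ix|->].
    apply/ffunP => j; apply/val_inj; rewrite /= idxE//.
    have := ix j; rewrite mem_grid_itv//; first by move/eqP.
    by have := cx j; rewrite in_itv/= => /andP[].
  move=> j; rewrite mem_grid_itv// ?idxE//.
  by have := cx j; rewrite in_itv/= => /andP[].
have hE k x : cube x -> h k x = f (node k (idx k x)).
  move=> cx; rewrite /h (bigD1 (idx k x))//= big1 ?addr0.
    by rewrite indicE mem_set ?mulr1//; apply/cellE.
  move=> i inx; rewrite indicE memNset ?mulr0// => /(cellE _ _ _ cx) ie.
  by rewrite ie eqxx in inx.
apply: (@measurable_fun_cvg _ _ _ _ h).
  move=> k; apply: measurable_sum => i; apply: measurable_funM => //.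
  by apply: measurable_indic; exact: measurable_hcube.
move=> x cx; apply/cvgrPdist_lt => e e0.
have [r r0 rP] := within_cube_dist cf cx e0.
near=> k; rewrite distrC hE//; apply: rP.
  move=> j; rewrite mxE in_itv/= divr_ge0//= ler_pdivrMr// mul1r ler_nat.
  by rewrite -ltnS.
apply: (@le_lt_trans _ _ k.+1%:R^-1).
  apply: norm_rV_le => // j; rewrite !mxE idxE//.
  have := cx j; rewrite in_itv/= => /andP[x0 x1].
  have := mem_grid_itv (Num.truncn (x ord0 j * k.+1%:R)) (ltn0Sn k) x0.
  rewrite eqxx in_itv/= => /andP[h1 h2].
  by rewrite ler0_norm ?subr_le0// opprB lerBlDl ltW.
near: k; have := near_infty_natSinv_lt (PosNum r0); exact.
Unshelve. all: by end_near. Qed.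

Lemma measurable_row_upd j (g : 'rV[R]_d -> R) : measurable_fun setT g ->
  measurable_fun setT (fun x => row_upd x j (g x)).
Proof.
move=> mg; apply: measurable_fun_rVP => i.
under eq_fun do rewrite mxE.
by case: eqP => // _; exact: measurable_rV_coord.
Qed.

(** A partial derivative is a limit of difference quotients. Their
    increment points towards the middle of the cube, so that every quotient
    only involves values of f on the cube, on its boundary as well. *)
Lemma measurable_cube_partial f j : cube_differentiable f ->
  measurable_fun cube (fun x => cube_gradient f x ord0 j).
Proof.
move=> df; have cf := cube_differentiable_continuous df.
pose F : 'rV[R]_d -> R := f \_ cube.
have mF : measurable_fun setT F.
  apply/(measurable_restrictT _ _).1; first exact: measurable_unit_cube.
  exact: measurable_cube_continuous.
pose s (x : 'rV[R]_d) : R := if x ord0 j <= 2^-1 then 1 else -1.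
have ms : measurable_fun setT s.
  apply: measurable_fun_ifT => //; apply: measurable_fun_ler => //.
  exact: measurable_rV_coord.
have s2 x : s x * s x = 1 by rewrite /s; case: ifP => _; rewrite ?mulr1// mulrNN mulr1.
pose u k x := row_upd x j (x ord0 j + s x * k.+2%:R^-1).
pose h k x := (F (u k x) - F x) * (s x * k.+2%:R).
have mu k : measurable_fun setT (u k).
  apply: measurable_row_upd; apply: measurable_funD.
    exact: measurable_rV_coord.
  exact: measurable_funM.
apply: (@measurable_fun_cvg _ _ _ _ h).
  move=> k; apply: measurable_funTS; apply: measurable_funM.
    by apply: measurable_funB => //; exact: measurableT_comp (mu k).
  exact: measurable_funM.
move=> x cx; apply/cvgrPdist_le => e e0.
have [r r0 rP] := cube_partial_dist j df cx e0.
near=> k.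
have k2 : k.+2%:R^-1 <= 2^-1 :> R by rewrite lef_pV2 ?posrE// ler_nat.
have k0 : 0 < k.+2%:R^-1 :> R by rewrite invr_gt0.
have xj := cx j.
set t := x ord0 j + s x * k.+2%:R^-1.
have t01 : t \in `[0, 1].
  move: xj k2 k0; rewrite /t /s !in_itv/=; set z := k.+2%:R^-1 => /andP[x0 x1] k2 k0.
  by case: (leP (x ord0 j)) => xh; apply/andP; split; lra.
have tx : t - x ord0 j = s x * k.+2%:R^-1 by rewrite /t addrAC subrr add0r.
have ntx : `|t - x ord0 j| = k.+2%:R^-1.
  rewrite tx normrM (ger0_norm (ltW k0)) /s.
  by case: ifP; rewrite ?normrN normr1 mul1r.
have hx : h k x = (f (row_upd x j t) - f x) * (s x * k.+2%:R).
  rewrite /h /F /u !patchE -/t mem_set; last exact: unit_cube_upd.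
  by rewrite mem_set.
have -> : cube_gradient f x ord0 j - h k x =
   - (f (row_upd x j t) - f x - cube_gradient f x ord0 j * (t - x ord0 j)) *
     (s x * k.+2%:R).
  have key : s x * k.+2%:R^-1 * (s x * k.+2%:R) = 1.
    by rewrite mulrACA s2 mulVf// mulr1.
  by rewrite hx tx mulNr [in RHS]mulrBl -[in RHS]mulrA key mulr1 opprB.
have ns : `|s x| = 1 by rewrite /s; case: ifP; rewrite ?normrN normr1.
rewrite normrM normrN normrM ns mul1r normr_nat -ler_pdivlMr// -ntx.
apply: rP => //; rewrite ntx.
apply: (@le_lt_trans _ _ k.+1%:R^-1); first by rewrite lef_pV2 ?posrE// ler_nat.
near: k; have := near_infty_natSinv_lt (PosNum r0); exact.
Unshelve. all: by end_near. Qed.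

Lemma measurable_cube_gradient_norm f : cube_differentiable f ->
  measurable_fun cube (fun x => euclidean_norm (cube_gradient f x)).
Proof.
move=> df; rewrite /euclidean_norm.
apply: (measurableT_comp (continuous_measurable_fun (@sqrt_continuous R))).
apply: measurable_sum => j; apply: measurable_funX.
exact: measurable_cube_partial.
Qed.

End measurability.

(** * The gradient controls increments along lines *)

Section averages.
Context {R : realType} (d : nat) (f : 'rV[R]_d -> R).
Hypothesis df : cube_differentiable f.
Implicit Types (v c : 'rV[R]_d) (j : 'I_d).
Local Notation cube := (@unit_cube R d).
Local Notation mu := (@lebesgue_measure R).

(** The values of f off the cube are arbitrary; extending f and the norm of its
    gradient by zero makes them measurable on the whole space. *)
Definition cube_ext : 'rV[R]_d -> R := f \_ cube.
Definition cube_grad : 'rV[R]_d -> \bar R :=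
  (fun x => (euclidean_norm (cube_gradient f x))%:E) \_ cube.

Let G := cube_grad.
Let g : 'rV[R]_d -> R := (fun x => euclidean_norm (cube_gradient f x)) \_ cube.

Let GE v : G v = (g v)%:E.
Proof. by rewrite /G /cube_grad /g !patchE; case: ifP. Qed.

Let mg : measurable_fun setT g.
Proof.
apply/(measurable_restrictT _ _).1; first exact: measurable_unit_cube.
exact: measurable_cube_gradient_norm.
Qed.

Lemma measurable_cube_grad : measurable_fun setT cube_grad.
Proof.
have -> : cube_grad = EFin \o g by apply/funext => v; exact: GE.
exact/measurable_EFinP.
Qed.
Let mG := measurable_cube_grad.

Let g0 v : (0 <= g v)%R.
Proof. by rewrite /g patchE; case: ifP => // _; exact: sqrtr_ge0. Qed.

Lemma cube_grad_ge0 v : 0 <= cube_grad v.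
Proof. by rewrite [cube_grad v]GE lee_fin. Qed.
Let G0 := cube_grad_ge0.

Lemma measurable_cube_ext : measurable_fun setT cube_ext.
Proof.
apply/(measurable_restrictT _ _).1; first exact: measurable_unit_cube.
apply: measurable_cube_continuous.
exact: cube_differentiable_continuous.
Qed.

Lemma cube_extE v : cube v -> cube_ext v = f v.
Proof. by move=> cv; rewrite /cube_ext patchE mem_set. Qed.

Lemma cube_ext_bounded : exists2 B : R, (0 <= B)%R & forall v, (`|cube_ext v| <= B)%R.
Proof.
have [B B0 BP] := within_cube_bounded (cube_differentiable_continuous df).
exists B => // v; rewrite /cube_ext patchE; case: ifP => [/set_mem/BP//|_].
by rewrite normr0.
Qed.

Lemma measurable_row_upd_line v j :
  measurable_fun setT (fun t : measurableTypeR R => row_upd v j t).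
Proof.
apply: measurable_fun_rVP => i; under eq_fun do rewrite mxE.
by case: eqP => _; [exact: measurable_id|exact: measurable_cst].
Qed.

Lemma line_le_integral v j a b : cube v -> (0 <= a)%R -> (a <= b)%R ->
  (b <= 1)%R ->
  `|f (row_upd v j b) - f (row_upd v j a)|%:E <=
  \int[mu]_(t in `[a, b]) cube_grad (row_upd v j t).
Proof.
move=> cv a0 ab b1.
have ab01 t : t \in `[a, b] -> t \in `[0%R, 1%R].
  by rewrite !in_itv/= => /andP[/(le_trans a0)-> /le_trans->].
have cu t : t \in `[a, b] -> cube (row_upd v j t).
  by move=> /ab01; exact: unit_cube_upd.
under eq_integral do rewrite [cube_grad _]GE.
pose f1 t := f (row_upd v j t).
pose g1 (t : measurableTypeR R) := g (row_upd v j t).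
suff : `|f1 b - f1 a|%:E <= \int[mu]_(t in `[a, b]) (g1 t)%:E by [].
apply: dini_le_integral ab _ (fun t _ => g0 _) _ _.
- apply: measurable_funTS.
  exact: measurableT_comp mg (measurable_row_upd_line v j).
- apply/subspace_continuousP => t tab; apply/cvgrPdist_lt => e e0.
  have [r r0 rP] := within_cube_dist (cube_differentiable_continuous df)
    (cu t tab) e0.
  rewrite near_withinE nearE; apply/nbhs_ballP; exists r => // s.
  rewrite /ball/= => ts sab; rewrite distrC; apply: rP; first exact: cu.
  rewrite -(row_upd_upd v j t s) (le_lt_trans (norm_row_updB _ _ _))//.
  by rewrite row_updE distrC.
- move=> t tab e e0.
  have tab' : t \in `[a, b].
    by move: tab; rewrite !in_itv/= => /andP[-> /ltW].
  have [r r0 rP] := cube_partial_dist j df (cu t tab') e0.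
  have tb : (t < b)%R by move: tab; rewrite in_itv/= => /andP[].
  near=> s.
  have ts : (t < s)%R by near: s; exact: nbhs_right_gt.
  have sb : (s < b)%R by near: s; exact: nbhs_right_lt.
  have str : (s < t + r)%R by near: s; apply: nbhs_right_lt; rewrite ltrDl.
  have sab : s \in `[a, b].
    move: tab'; rewrite !in_itv/= => /andP[at_ _].
    by rewrite (le_trans at_ (ltW ts)) ltW.
  have nst : (`|s - t| = s - t)%R by rewrite gtr0_norm// subr_gt0.
  have := rP s (ab01 _ sab); rewrite row_upd_upd row_updE nst ltrBlDl => /(_ str).
  set D := cube_gradient _ _ _ _ => h.
  rewrite -[(_ - f (row_upd v j t))%R](subrK (D * (s - t))%R).
  apply: le_trans (ler_normD _ _) _; rewrite mulrDl addrC lerD//.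
  rewrite normrM nst ler_wpM2r ?subr_ge0 ?(ltW ts)//.
  rewrite /g patchE mem_set; last exact: cu.
  exact: normr_coord_le_euclidean.
Unshelve. all: by end_near. Qed.

Lemma hcube_line_le a w v j s : hcube a w `<=` cube -> hcube a w v ->
  s \in `[a j, (a j + w)%R[ ->
  `|cube_ext (row_upd v j s) - cube_ext v|%:E <=
  \int[mu]_(t in `[a j, (a j + w)%R[) cube_grad (row_upd v j t).
Proof.
move=> sub av sj.
have av' t : t \in `[a j, (a j + w)%R[ -> hcube a w (row_upd v j t).
  by move=> tj i; rewrite mxE; case: eqP => [->//|_]; exact: av.
have cv' t (tj : t \in `[a j, (a j + w)%R[) := sub _ (av' t tj).
rewrite !cube_extE; [|exact: sub|exact: cv'].
have vj := av j.
have t01 t : t \in `[a j, (a j + w)%R[ -> (0 <= t <= 1)%R.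
  by move=> /cv'/(_ j); rewrite row_updE in_itv.
have mint (D : set R) (mD : measurable (D : set (measurableTypeR R))) :
    measurable_fun (D : set (measurableTypeR R)) (fun t => G (row_upd v j t)).
  by apply: measurable_funTS; exact: measurableT_comp mG (measurable_row_upd_line v j).
have sub_int x y : x \in `[a j, (a j + w)%R[ -> y \in `[a j, (a j + w)%R[ ->
    \int[mu]_(t in `[x, y]) G (row_upd v j t) <=
    \int[mu]_(t in `[a j, (a j + w)%R[) G (row_upd v j t).
  rewrite !in_itv/= => /andP[x1 x2] /andP[y1 y2].
  apply: ge0_subset_integral; [exact: measurable_itv|exact: measurable_itv| | |].
  - by apply: mint; exact: measurable_itv.
  - by move=> t _; exact: G0.
  - by apply: subset_itv; rewrite bnd_simp.
have /andP[vj0 vj1] := t01 _ vj; have /andP[s0 s1] := t01 _ sj.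
have [vs|/ltW sv] := leP (v ord0 j) s.
  have := line_le_integral j (sub _ av) vj0 vs s1.
  by rewrite row_upd_id => /le_trans; apply; exact: sub_int.
have := line_le_integral j (sub _ av) s0 sv vj1.
by rewrite row_upd_id distrC => /le_trans; apply; exact: sub_int.
Qed.

End averages.

(** * Means over concentric cubes *)

Section centered_cubes.
Context {R : realType} (d : nat) (f : 'rV[R]_d -> R).
Hypotheses (hd : (1 <= d)%N) (df : cube_differentiable f).
Implicit Types (v c : 'rV[R]_d) (j : 'I_d).
Local Notation cube := (@unit_cube R d).
Local Notation leb := (@lebesgue_rV R d).
Local Notation F := (cube_ext f).
Local Notation G := (cube_grad f).

Definition ccube c (s : R) : set 'rV[R]_d :=
  hcube (fun j => c ord0 j - s / 2)%R s.

Definition cube_avg c (s : R) : R :=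
  ((\int[leb]_(v in ccube c s) F v) / s ^+ d)%R.

Lemma measurable_ccube c s : measurable (ccube c s).
Proof. exact: measurable_hcube. Qed.
Hint Resolve measurable_ccube : core.

Lemma lebesgue_ccube c s : (0 <= s)%R -> leb (ccube c s) = (s ^+ d)%:E.
Proof. exact: lebesgue_hcube. Qed.

Lemma ccube_dist c s v : (0 <= s)%R -> ccube c s v -> (`|v - c| <= s)%R.
Proof.
move=> s0 cv; apply: norm_rV_le => // j; have := cv j.
rewrite in_itv/= !mxE ler_norml => /andP[h1 h2]; apply/andP; split; lra.
Qed.

Lemma sub_ccube c r s : (r <= s)%R -> ccube c r `<=` ccube c s.
Proof. by move=> rs; apply: sub_hcube => j; split; lra. Qed.

Lemma integrable_cube_ext c s : (0 <= s)%R ->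
  leb.-integrable (ccube c s) (EFin \o F).
Proof.
move=> s0; have [B B0 BP] := cube_ext_bounded df.
apply: measurable_bounded_integrable => //.
- by rewrite [X in X < _]lebesgue_ccube// ltry.
- by apply: measurable_funTS; exact: measurable_cube_ext.
- exists B; split; first exact: num_real.
  by move=> x /ltW Bx v _; exact: le_trans (BP v) Bx.
Qed.

Lemma integrable_ccube_cst c s (B : R) : (0 <= s)%R ->
  leb.-integrable (ccube c s) (EFin \o cst B).
Proof.
move=> s0; apply: measurable_bounded_integrable => //.
  by rewrite [X in X < _]lebesgue_ccube// ltry.
exists `|B|%R; split; first exact: num_real.
by move=> x /ltW Bx v _.
Qed.

(** [hcube_compare] requires a nonnegative function: it is applied to f plus a
    bound of |f|, which shifts both means equally. *)
Lemma cube_avg_compare c r w : (0 < r)%R -> (r <= w)%R ->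
  ccube c w `<=` cube ->
  `|cube_avg c w - cube_avg c r|%:E <=
  (d%:R * r ^- d.-1)%:E * \int[leb]_(v in ccube c w) G v.
Proof.
move=> r0 rw sub; have w0 : (0 < w)%R by exact: lt_le_trans rw.
have [B B0 BP] := cube_ext_bounded df.
pose H v := (F v + B)%:E.
have mH : measurable_fun setT H.
  apply/measurable_EFinP; apply: measurable_funD => //.
  exact: measurable_cube_ext.
have H0 v : 0 <= H v.
  by rewrite lee_fin -lerBlDr sub0r; have := BP v; rewrite ler_norml => /andP[].
pose I s := (\int[leb]_(v in ccube c s) F v)%R.
have HI s : (0 <= s)%R -> \int[leb]_(v in ccube c s) H v = (I s + B * s ^+ d)%:E.
  move=> s0; rewrite /H; under eq_integral do rewrite EFinD.
  rewrite integralD//; last 2 first.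
  - exact: integrable_cube_ext.
  - exact: integrable_ccube_cst.
  rewrite integral_cst// [X in _ * X]lebesgue_ccube// EFinD EFinM; congr (_ + _).
  rewrite /I /Rintegral fineK//.
  by apply: integrable_fin_num => //; exact: integrable_cube_ext.
set J := \int[leb]_(v in ccube c w) G v.
have J0 : 0 <= J by apply: integral_ge0 => v _; exact: cube_grad_ge0.
have FG v j s : ccube c w v -> s \in `[(c ord0 j - w / 2)%R, (c ord0 j - w / 2 + w)%R[ ->
    H (row_upd v j s) <= H v + \int[lebesgue_measure]_(t in
      `[(c ord0 j - w / 2)%R, (c ord0 j - w / 2 + w)%R[) G (row_upd v j t).
  move=> cv sj; have := hcube_line_le df sub cv sj.
  rewrite /H => h; rewrite EFinD [(F v + B)%:E]EFinD addeAC leeD2r//.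
  rewrite -leeBlDl// -EFinB (le_trans _ h)// lee_fin ler_norm.
  done.
have cw j : (c ord0 j - w / 2 <= c ord0 j - w / 2 /\
    c ord0 j - w / 2 + w <= c ord0 j - w / 2 + w)%R by [].
have cr j : (c ord0 j - w / 2 <= c ord0 j - r / 2 /\
    c ord0 j - r / 2 + r <= c ord0 j - w / 2 + w)%R by split; lra.
have mG := measurable_cube_grad df.
have G0 := cube_grad_ge0 f.
(* One inequality in each direction. *)
have := hcube_compare (ltW w0) (ltW r0) (lexx w) rw cw cr mH mG H0 G0 FG.
have := hcube_compare (ltW r0) (ltW w0) rw (lexx w) cr cw mH mG H0 G0 FG.
rewrite -!/(ccube _ _) (HI r (ltW r0)) (HI w (ltW w0)) -/J.
have wd0 : (0 < w ^+ d)%R by rewrite exprn_gt0.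
have rd0 : (0 < r ^+ d)%R by rewrite exprn_gt0.
have K0 : (0 < d%:R * r ^- d.-1 :> R)%R.
  by rewrite mulr_gt0 ?ltr0n// invr_gt0 exprn_gt0.
case: J J0 => [J| |] // J0 h1 h2; last by rewrite gt0_muley ?leey ?lte_fin.
move: h1 h2; rewrite -!EFinM -!EFinD !lee_fin => h1 h2.
have wE : (w ^+ d = w * w ^+ d.-1)%R by rewrite -exprS prednK.
have rE : (r ^+ d = r * r ^+ d.-1)%R by rewrite -exprS prednK.
have rd10 : (r ^+ d.-1 != 0)%R by rewrite expf_neq0// gt_eqF.
rewrite /cube_avg -/(I w) -/(I r).
have -> : (I w / w ^+ d - I r / r ^+ d =
    (r ^+ d * I w - w ^+ d * I r) / (w ^+ d * r ^+ d))%R.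
  by field; rewrite !gt_eqF.
have wr0 : (0 < w ^+ d * r ^+ d)%R by rewrite mulr_gt0.
rewrite normrM normfV (gtr0_norm wr0) ler_pdivrMr//.
have -> : (d%:R / r ^+ d.-1 * J * (w ^+ d * r ^+ d) =
    d%:R * (w * r * w ^+ d.-1) * J)%R.
  by rewrite rE wE; field.
rewrite ler_norml; apply/andP; split; lra.
Qed.

End centered_cubes.

(** * From means to values at the centre *)

Section center_value.
Context {R : realType} (d : nat) (f : 'rV[R]_d -> R).
Hypotheses (hd : (1 <= d)%N) (df : cube_differentiable f).
Implicit Types c : 'rV[R]_d.
Local Notation cube := (@unit_cube R d).
Local Notation leb := (@lebesgue_rV R d).
Local Notation F := (cube_ext f).
Local Notation G := (cube_grad f).

Lemma cube_avg_near c (e : R) : cube c -> (0 < e)%R ->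
  exists2 r, (0 < r)%R & forall s, (0 < s)%R -> (s < r)%R ->
    ccube c s `<=` cube -> (`|cube_avg f c s - f c| <= e)%R.
Proof.
move=> cc e0; have [r r0 rP] := within_cube_dist (cube_differentiable_continuous df) cc e0.
exists r => // s s0 sr sub.
have mc : measurable (ccube c s) by exact: measurable_ccube.
have iF := integrable_cube_ext df c (ltW s0).
have ik (k : R) := integrable_ccube_cst c k (ltW s0).
have sd0 : (0 < s ^+ d)%R by rewrite exprn_gt0.
have cst_int (k : R) : (\int[leb]_(v in ccube c s) (cst k v) = k * s ^+ d)%R.
  by rewrite Rintegral_cst// [X in fine X]lebesgue_ccube// ltW.
have -> : (cube_avg f c s - f c =
    (\int[leb]_(v in ccube c s) (F v - cst (f c) v)) / s ^+ d)%R.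
  rewrite RintegralB// cst_int /cube_avg mulrBl mulfK// gt_eqF//.
rewrite normrM normfV (gtr0_norm sd0) ler_pdivrMr//.
have iB : leb.-integrable (ccube c s) (EFin \o (fun v => F v - cst (f c) v)%R).
  by have := integrableB mc iF (ik (f c)); apply: eq_integrable => // v _.
apply: le_trans (le_normr_Rintegral mc iB) _.
rewrite -(cst_int e); apply: le_Rintegral => //.
  exact: integrable_norm.
move=> v cv; have cuv := sub _ cv; rewrite cube_extE//.
apply/ltW/rP => //; apply: le_lt_trans sr.
exact: ccube_dist (ltW s0) cv.
Qed.

(** The small cube of side r serves only to reach the centre: the first term is
    independent of r in dimension one. *)
Lemma cube_avg_center_le c w (e : R) : cube c -> (0 < w)%R ->
  ccube c w `<=` cube -> (0 < e)%R ->
  exists2 r0, (0 < r0)%R & forall r, (0 < r)%R -> (r < r0)%R ->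
    `|cube_avg f c w - f c|%:E <=
    (d%:R * r ^- d.-1)%:E * \int[leb]_(v in ccube c w) G v + e%:E.
Proof.
move=> cc w0 sub e0; have [r0 r00 rP] := cube_avg_near cc e0.
exists (Num.min r0 w) => [|r rp]; first by rewrite lt_min r00.
rewrite lt_min => /andP[rr0 rw].
have -> : (cube_avg f c w - f c = (cube_avg f c w - cube_avg f c r) +
    (cube_avg f c r - f c))%R by rewrite addrA subrK.
apply: (@le_trans _ _ (`|cube_avg f c w - cube_avg f c r|%:E + `|cube_avg f c r - f c|%:E)).
  by rewrite -EFinD lee_fin ler_normD.
rewrite leeD//; first exact: cube_avg_compare (ltW rw) sub.
rewrite lee_fin; apply: rP => //; apply: subset_trans sub.
exact/sub_ccube/ltW.
Qed.

(** Halving the side s moves the mean by at most d 2^d M s/2; summing this over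
    the sides r, r/2, r/4, ... gives the geometric series with sum d 2^d M r. *)
Lemma cube_avg_lipschitz c r (M : R) : cube c -> (0 < r)%R -> (0 <= M)%R ->
  ccube c r `<=` cube ->
  (forall s, (0 < s)%R -> (s <= r)%R ->
     \int[leb]_(v in ccube c s) G v <= (M * s ^+ d)%:E) ->
  (`|cube_avg f c r - f c| <= d%:R * 2 ^+ d * M * r)%R.
Proof.
move=> cc r0 M0 sub GM.
have half s : (0 < s)%R -> (s <= r)%R ->
    (`|cube_avg f c s - cube_avg f c (s / 2)| <= d%:R * 2 ^+ d * M * (s / 2))%R.
  move=> s0 sr.
  have s20 : (0 < s / 2)%R by rewrite divr_gt0.
  have s2s : (s / 2 <= s)%R by lra.
  have := cube_avg_compare hd df s20 s2s (subset_trans (sub_ccube (d := d) (c := c) sr) sub).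
  rewrite -lee_fin => /le_trans; apply.
  apply: (@le_trans _ _ ((d%:R * (s / 2) ^- d.-1)%:E * (M * s ^+ d)%:E)).
    rewrite lee_wpmul2l ?GM// lee_fin mulr_ge0// invr_ge0 exprn_ge0// ltW//.
  rewrite -EFinM lee_fin exprMn exprVn invfM invrK.
  have -> : (s ^+ d = s * s ^+ d.-1)%R by rewrite -exprS prednK.
  have -> : (2 ^+ d = 2 * 2 ^+ d.-1 :> R)%R by rewrite -exprS prednK.
  rewrite le_eqVlt; apply/orP; left; apply/eqP; field.
  by rewrite expf_neq0// gt_eqF.
set K := (d%:R * 2 ^+ d * M)%R in half *.
have K0 : (0 <= K)%R by rewrite !mulr_ge0.
have rn n : (0 < r / 2 ^+ n <= r)%R.
  rewrite divr_gt0 ?exprn_gt0//= ler_pdivrMr ?exprn_gt0// ler_peMr ?(ltW r0)//.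
  by rewrite -natrX ler1n expn_gt0.
have dyadic n : (`|cube_avg f c r - cube_avg f c (r / 2 ^+ n)| <= K * (r - r / 2 ^+ n))%R.
  elim: n => [|n IHn]; first by rewrite expr0 divr1 !subrr mulr0 normr0.
  have /andP[rn0 rnr] := rn n.
  have h := half _ rn0 rnr.
  have -> : (r / 2 ^+ n.+1 = r / 2 ^+ n / 2)%R by rewrite exprSr invfM mulrA.
  rewrite -(subrK (cube_avg f c (r / 2 ^+ n)) (cube_avg f c r)) -addrA.
  apply: le_trans (ler_normD _ _) _.
  have -> : (K * (r - r / 2 ^+ n / 2) = K * (r - r / 2 ^+ n) + K * (r / 2 ^+ n / 2))%R.
    by field; rewrite gt_eqF.
  exact: lerD.
apply/ler_addgt0Pr => e e0.
have [s s0 sP] := cube_avg_near cc e0.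
have [n ns] : exists n, (r / 2 ^+ n < s)%R.
  exists (Num.truncn (r / s)).+1.
  rewrite ltr_pdivrMr ?exprn_gt0// mulrC -ltr_pdivrMr//.
  apply: lt_le_trans (truncnS_gt _) _.
  by rewrite -natrX ler_nat ltnW// ltn_expl.
have /andP[rn0 rnr] := rn n.
rewrite -(subrK (cube_avg f c (r / 2 ^+ n)) (cube_avg f c r)) -addrA.
apply: le_trans (ler_normD _ _) _; apply: lerD.
  apply: le_trans (dyadic n) _; rewrite ler_wpM2l//.
  by rewrite gerBl ltW.
by apply: sP => //; apply: subset_trans sub; exact: sub_ccube.
Qed.
End center_value.

(** * Summation over the grid *)

Section quadrature.
Context {R : realType} (d : nat) (f : 'rV[R]_d -> R).
Hypothesis df : cube_differentiable f.
Context (m : nat).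
Hypothesis m0 : (0 < m)%N.
Local Notation cube := (@unit_cube R d).
Local Notation leb := (@lebesgue_rV R d).
Local Notation F := (cube_ext f).
Local Notation G := (cube_grad f).
Local Notation hQ := (hcube (fun _ : 'I_d => 0%R : R) 1).
Local Notation point := (@grid_point R d m).
Let cell (i : {ffun 'I_d -> 'I_m}) : set 'rV[R]_d := ccube (point i) m%:R^-1.

Let mR : (0 < m%:R :> R)%R. Proof. by rewrite ltr0n. Qed.

Let cellE i v : cell i v <-> forall j,
  v ord0 j \in `[((i j)%:R / m%:R)%R, ((i j)%:R / m%:R + m%:R^-1)%R[.
Proof.
have e j : (point i ord0 j - m%:R^-1 / 2 = (i j)%:R / m%:R :> R)%R.
  by rewrite mxE -natr1; field; rewrite gt_eqF.
by split => h j; have := h j; rewrite e.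
Qed.

Lemma hcube01_sub : hQ `<=` cube.
Proof.
move=> v hv j; have := hv j; rewrite !in_itv/= add0r.
by move=> /andP[-> /ltW].
Qed.

Let cell_sub01 i : cell i `<=` hQ.
Proof.
move=> v /cellE h j; have := h j; rewrite !in_itv/= add0r => /andP[h1 h2].
rewrite (le_trans _ h1) ?divr_ge0//= (lt_le_trans h2)//.
by rewrite -[X in (_ + X)%R]mul1r -mulrDl natr1 ler_pdivrMr// mul1r ler_nat.
Qed.

Lemma grid_cell_sub i : ccube (point i) m%:R^-1 `<=` cube.
Proof. by apply: subset_trans hcube01_sub; exact: cell_sub01. Qed.

Lemma grid_point_in_cube i : cube (point i).
Proof.
move=> j; have mlt : ((i j).+1%:R <= m%:R :> R)%R by rewrite ler_nat.
have i0 : (0 <= (i j)%:R :> R)%R by [].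
rewrite in_itv/= mxE; move: mlt; rewrite -natr1 => mlt.
have m2 : (0 < 2 * m%:R :> R)%R by rewrite mulr_gt0.
apply/andP; split; first by apply: divr_ge0 (ltW m2); lra.
by rewrite ler_pdivrMr// mul1r; lra.
Qed.

Let trunc_cell i v : cell i v -> forall j, i j = Num.truncn (v ord0 j * m%:R) :> nat.
Proof.
move=> cv j; have hv := cell_sub01 cv j.
have v0 : (0 <= v ord0 j)%R by move: hv; rewrite in_itv/= => /andP[].
by have /cellE/(_ j) := cv; rewrite mem_grid_itv// => /eqP.
Qed.

Let triv : trivIset [set` index_enum {ffun 'I_d -> 'I_m}] cell.
Proof.
apply/trivIsetP => i k _ _ ik; rewrite -subset0 => v [iv kv].
move/eqP : ik; apply; apply/ffunP => j; apply/val_inj => /=.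
by rewrite (trunc_cell iv) (trunc_cell kv).
Qed.

Let coverE : \big[setU/set0]_(i <- index_enum {ffun 'I_d -> 'I_m}) cell i = hQ.
Proof.
rewrite -bigcup_seq; apply/seteqP; split => [v [i _]|v hv].
  exact: cell_sub01.
have tr j : (Num.truncn (v ord0 j * m%:R) < m)%N.
  have := hv j; rewrite in_itv/= add0r => /andP[v0 v1].
  rewrite -(ltr_nat R) (le_lt_trans (y := (v ord0 j * m%:R)%R))//.
    by rewrite truncn_le mulr_ge0.
  by rewrite gtr_pMl.
exists [ffun j => Ordinal (tr j)]; first by rewrite /= mem_index_enum.
apply/cellE => j; rewrite mem_grid_itv// ?ffunE//.
by have := hv j; rewrite in_itv/= => /andP[].
Qed.

Let mcell i : measurable (cell i). Proof. exact: measurable_ccube. Qed.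

Lemma lebesgue_unit_cube : leb cube = 1.
Proof.
rewrite [LHS](@lebesgue_rV_box R d (fun=> `[0%R, 1%R]%classic))//.
under eq_bigr do rewrite lebesgue_measure_itv/= lte_fin ltr01 sube0.
by rewrite big1.
Qed.

Lemma lebesgue_cube_boundary : leb (cube `\` hQ) = 0.
Proof.
have mQ : measurable hQ by exact: measurable_hcube.
have lQ : leb hQ = 1 by rewrite lebesgue_hcube// expr1n.
rewrite measureD//; last 2 first.
- exact: measurable_unit_cube.
- by rewrite [X in X < _]lebesgue_unit_cube ltry.
rewrite [X in X - _]lebesgue_unit_cube setIC setIidl; last exact: hcube01_sub.
by rewrite [X in _ - X]lQ subee.
Qed.

Lemma integral_cube_grid :
  \int[leb]_(v in cube) (f v)%:E =
  (m%:R ^- d * \sum_i cube_avg f (point i) m%:R^-1)%R%:E.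
Proof.
have mQ : measurable hQ by exact: measurable_hcube.
have [B B0 BP] := cube_ext_bounded df.
have -> : \int[leb]_(v in cube) (f v)%:E = \int[leb]_(v in cube) (F v)%:E.
  by apply: eq_integral => v /set_mem cv; rewrite cube_extE.
have iF : leb.-integrable cube (EFin \o F).
  apply: measurable_bounded_integrable.
  - exact: measurable_unit_cube.
  - by rewrite [X in X < _]lebesgue_unit_cube ltry.
  - by apply: measurable_funTS; exact: measurable_cube_ext.
  - exists B; split; first exact: num_real.
    by move=> x /ltW Bx v _; exact: le_trans (BP v) Bx.
rewrite (@negligible_integral _ _ _ _ _ (cube `\` hQ) _ _ _ iF); last 3 first.
- by apply: measurableD => //; exact: measurable_unit_cube.
- exact: measurable_unit_cube.
- exact: lebesgue_cube_boundary.
rewrite setDD setIC setIidl; last exact: hcube01_sub.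
rewrite -coverE integral_bigsetU_EFin//; last 2 first.
- exact: index_enum_uniq.
- by apply: measurable_funTS; apply/measurable_EFinP; exact: measurable_cube_ext.
rewrite mulr_sumr -sumEFin; apply: eq_bigr => i _.
have mi0 : (0 <= m%:R^-1 :> R)%R by rewrite invr_ge0.
rewrite /cube_avg exprVn invrK mulrC mulfK; last by rewrite expf_neq0// gt_eqF.
rewrite /Rintegral fineK//; apply: integrable_fin_num; first exact: measurable_ccube.
exact: integrable_cube_ext.
Qed.

Lemma grid_integral_grad_le :
  \sum_i \int[leb]_(v in ccube (point i) m%:R^-1) G v <= \int[leb]_(v in cube) G v.
Proof.
have mG := measurable_cube_grad df.
rewrite -(@ge0_integral_bigsetU _ _ _ leb _ cell)//; last 3 first.
- exact: index_enum_uniq.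
- exact: measurable_funTS.
- by move=> v _; exact: cube_grad_ge0.
rewrite coverE; apply: ge0_subset_integral.
- exact: measurable_hcube.
- exact: measurable_unit_cube.
- exact: measurable_funTS.
- by move=> v _; exact: cube_grad_ge0.
- exact: hcube01_sub.
Qed.

(** The integral is the mean over the grid of the cell means, so the error of the
    quadrature is at most the mean of the errors on the cells; the integrals of
    the gradient over the disjoint cells add up. *)
Lemma quadrature_error_le (K e : R) : (0 <= K)%R -> (0 <= e)%R ->
  (forall i, `|cube_avg f (point i) m%:R^-1 - f (point i)|%:E <=
    K%:E * \int[leb]_(v in ccube (point i) m%:R^-1) G v + e%:E) ->
  `| \int[leb]_(v in cube) (f v)%:E
     - ((m ^ d)%:R^-1 * \sum_(i : {ffun 'I_d -> 'I_m}) f (grid_point i))%R%:E | <=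
  (m%:R ^- d * K)%:E * \int[leb]_(v in cube) G v + e%:E.
Proof.
move=> K0 e0 h; rewrite integral_cube_grid -EFinB natrX -mulrBr -sumrB.
have md0 : (0 < m%:R ^+ d :> R)%R by rewrite exprn_gt0.
rewrite abse_EFin normrM normfV (gtr0_norm md0).
apply: (@le_trans _ _ ((m%:R ^- d)%:E * \sum_i
    (K%:E * \int[leb]_(v in ccube (point i) m%:R^-1) G v + e%:E))).
  rewrite EFinM lee_wpmul2l ?lee_fin ?invr_ge0 ?(ltW md0)//.
  apply: (@le_trans _ _ (\sum_i `|cube_avg f (point i) m%:R^-1 - f (point i)|%:E)).
    by rewrite sumEFin lee_fin ler_norm_sum.
  exact: lee_sum.
rewrite big_split/= -ge0_sume_distrr; last first.
  by move=> i _; apply: integral_ge0 => v _; exact: cube_grad_ge0.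
have -> : \sum_(i : {ffun 'I_d -> 'I_m}) e%:E = (m%:R ^+ d * e)%:E.
  by rewrite sumEFin sumr_const card_ffun !card_ord -natrX mulr_natl.
have J0 : 0 <= \sum_i \int[leb]_(v in ccube (point i) m%:R^-1) G v.
  apply: sume_ge0 => i _; apply: integral_ge0 => v _; exact: cube_grad_ge0.
rewrite ge0_muleDr ?mule_ge0 ?lee_fin ?mulr_ge0 ?(ltW md0)//.
rewrite muleA -!EFinM mulKf ?gt_eqF// leeD2r// lee_wpmul2l//.
  by rewrite lee_fin mulr_ge0// invr_ge0 ltW.
exact: grid_integral_grad_le.
Qed.

End quadrature.

(** * The two norms of the gradient and the choice of the scale *)

Section gradient_norms.
Context {R : realType} (d : nat) (f : 'rV[R]_d -> R).
Hypotheses (hd : (1 <= d)%N) (df : cube_differentiable f).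
Local Notation cube := (@unit_cube R d).
Local Notation leb := (@lebesgue_rV R d).
Local Notation G := (cube_grad f).
Local Notation I1 := (cube_gradient_Lnorm 1 f).
Local Notation Moo := (cube_gradient_Lnorm +oo f).

Lemma cube_gradient_Lnorm1E : I1 = \int[leb]_(v in cube) G v.
Proof.
rewrite /cube_gradient_Lnorm Lnorm1.
transitivity (\int[leb]_v G v).
  by apply: eq_integral => v _; rewrite gee0_abs//; exact: cube_grad_ge0.
rewrite [LHS](_ : _ = \int[leb]_(v in cube) (euclidean_norm (cube_gradient f v))%:E).
  by apply: eq_integral => v cv; rewrite /cube_grad patchE cv.
by rewrite [RHS]integral_mkcond.
Qed.

Lemma cube_grad_ae_le : \forall v \ae leb, G v <= Moo.
Proof.
have le0T : 0 < leb setT.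
  apply: (@lt_le_trans _ _ (leb cube)).
    by rewrite [X in _ < X]lebesgue_unit_cube.
  apply: le_measure; rewrite ?inE//; exact: measurable_unit_cube.
rewrite /cube_gradient_Lnorm unlock le0T.
apply: filterS (ess_sup_inf.ess_sup_ge leb (abse \o G)) => v /=.
by rewrite gee0_abs//; exact: cube_grad_ge0.
Qed.

Lemma integral_grad_le (M s : R) (D : set 'rV[R]_d) : Moo = M%:E ->
  measurable D -> leb D = s%:E -> \int[leb]_(v in D) G v <= (M * s)%:E.
Proof.
move=> ME mD Ds.
have M0 : 0 <= M%:E by rewrite -ME; exact: Lnorm_ge0.
apply: (@le_trans _ _ (\int[leb]_(v in D) M%:E)); last first.
  by rewrite integral_cst// [X in _ * X]Ds EFinM.
apply: ae_ge0_le_integral => //.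
- by move=> v _; exact: cube_grad_ge0.
- by apply: measurable_funTS; exact: measurable_cube_grad.
- by apply: filterS cube_grad_ae_le => v + _; rewrite ME.
Qed.

Section error.
Variable m : nat.
Hypothesis m0 : (0 < m)%N.
Let err := `| \int[leb]_(v in cube) (f v)%:E
     - ((m ^ d)%:R^-1 * \sum_(i : {ffun 'I_d -> 'I_m}) f (grid_point i))%R%:E |.

Let mV0 : (0 < m%:R^-1 :> R)%R. Proof. by rewrite invr_gt0 ltr0n. Qed.

(** In these two cases r^(1-d) I = I, and r can be sent to 0. *)
Lemma quadrature_error_L1 : (d == 1)%N || (I1 == 0) ->
  err <= (m%:R ^- d * d%:R)%:E * I1.
Proof.
move=> dI; apply/lee_addgt0Pr => e e0.
have : \forall r \near 0^'+, forall i : {ffun 'I_d -> 'I_m},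
    `|cube_avg f (grid_point i) m%:R^-1 - f (grid_point i)|%:E <=
    (d%:R * r ^- d.-1)%:E * \int[leb]_(v in ccube (grid_point i) m%:R^-1) G v + e%:E.
  apply: filter_forall => i.
  have [r0 r00 rP] := cube_avg_center_le hd df (grid_point_in_cube m0 i) mV0
    (@grid_cell_sub R d m m0 i) e0.
  near=> r; apply: rP.
    by near: r; exact: nbhs_right_gt.
  by near: r; exact: nbhs_right_lt.
move=> [t /= t0 tP].
have t20 : (0 < t / 2)%R by rewrite divr_gt0.
have := tP (t / 2)%R; rewrite /ball_/= sub0r normrN gtr0_norm// => h.
have {}h := h (ltac:(lra)) t20.
have K0 : (0 <= d%:R * (t / 2) ^- d.-1)%R.
  by rewrite mulr_ge0// invr_ge0 exprn_ge0// ltW.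
apply: le_trans (quadrature_error_le df m0 K0 (ltW e0) h) _.
rewrite leeD2r// -cube_gradient_Lnorm1E.
case/orP: dI => [/eqP d1|/eqP->]; last by rewrite !mule0.
have -> : d.-1 = 0%N by rewrite d1.
by rewrite expr0 invr1 mulr1.
Unshelve. all: by end_near. Qed.

(** Passing through the cube of side r inside each cell: the L^1 norm controls the
    part above the scale r, the supremum norm the part below. *)
Lemma quadrature_error_Loo (M r : R) : Moo = M%:E -> (0 < r)%R ->
  (r <= m%:R^-1)%R ->
  err <= (m%:R ^- d * (d%:R * r ^- d.-1))%:E * I1 + (d%:R * 2 ^+ d * M * r)%:E.
Proof.
move=> ME r0 rm.
have M0 : (0 <= M)%R by rewrite -lee_fin -ME; exact: Lnorm_ge0.
rewrite cube_gradient_Lnorm1E; apply: quadrature_error_le => // [||i].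
- by rewrite mulr_ge0// invr_ge0 exprn_ge0// ltW.
- by rewrite !mulr_ge0// ltW.
have sub := @grid_cell_sub R d m m0 i.
have subr := subset_trans (sub_ccube (c := grid_point i) rm) sub.
rewrite -(subrK (cube_avg f (grid_point i) r) (cube_avg f (grid_point i) m%:R^-1)) -addrA.
apply: (@le_trans _ _ (`|cube_avg f (grid_point i) m%:R^-1 -
    cube_avg f (grid_point i) r|%:E + `|cube_avg f (grid_point i) r - f (grid_point i)|%:E)).
  by rewrite -EFinD lee_fin ler_normD.
rewrite leeD//; first exact: cube_avg_compare.
rewrite lee_fin; apply: cube_avg_lipschitz => //; first exact: grid_point_in_cube.
move=> s s0 _; apply: integral_grad_le => //; first exact: measurable_ccube.
by apply: lebesgue_ccube; exact: ltW.
Qed.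

End error.
End gradient_norms.

(** With t = (I/M)^(1/d) one has M^((d-1)/d) I^(1/d) = M t, and at the scale
    r = t/m the two terms are d M t/m and d 2^d M t/m. *)
Lemma optimal_scale (R : realType) (d : nat) (m M I : R) : (1 <= d)%N ->
  (0 < m)%R -> (0 < M)%R -> (0 < I)%R -> (I <= M)%R ->
  exists r : R, [/\ (0 < r)%R, (r <= m^-1)%R &
    (m ^- d * (d%:R * r ^- d.-1) * I + d%:R * 2 ^+ d * M * r =
     d%:R * (1 + 2 ^+ d) * M `^ ((d%:R - 1) / d%:R) * I `^ (1 / d%:R) * m^-1)%R].
Proof.
move=> hd m0 M0 I0 IM.
have d0 : (0 < d%:R :> R)%R by rewrite ltr0n.
pose t := ((I / M) `^ (1 / d%:R))%R.
have t0 : (0 < t)%R by rewrite powR_gt0// divr_gt0.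
have td : (t ^+ d = I / M)%R.
  rewrite -powR_mulrn ?ltW// /t -powRrM div1r mulVf ?gt_eqF// powRr1//.
  by rewrite divr_ge0// ltW.
have t1 : (t <= 1)%R.
  apply: (@le_trans _ _ (1 `^ (1 / d%:R))%R); last by rewrite powR1.
  apply: ge0_ler_powR; rewrite ?nnegrE ?divr_ge0 ?(ltW M0) ?(ltW I0)//.
  by rewrite ler_pdivrMr// mul1r.
have MI : (M `^ ((d%:R - 1) / d%:R) * I `^ (1 / d%:R) = M * t)%R.
  have {1}-> : I = (I / M * M)%R by rewrite divfK// gt_eqF.
  rewrite powRM ?divr_ge0 ?(ltW M0) ?(ltW I0)// -/t mulrCA -powRD; last first.
    by rewrite (gt_eqF M0) implybT.
  rewrite -mulrDl subrK divff ?gt_eqF// powRr1 ?ltW// mulrC//.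
exists (t / m)%R; split; first by rewrite divr_gt0.
  by rewrite ler_pdivrMr// mulVf ?gt_eqF.
rewrite -[in RHS](mulrA _ (M `^ _)%R) MI.
have IE : I = (M * (t * t ^+ d.-1))%R.
  by rewrite -exprS prednK// td mulrC divfK// gt_eqF.
have mE : (m ^+ d = m * m ^+ d.-1)%R by rewrite -exprS prednK.
rewrite {1}IE mE expr_div_n; field.
by rewrite !gt_eqF ?exprn_gt0.
Qed.

Theorem theorem7 (R : realType) (d : nat) (hd : (1 <= d)%N) :
  exists2 c : R, (0 < c)%R &
  forall (m : nat) (hm : (1 <= m)%N) (N : nat) (hN : N = (m ^ d)%N)
    (f : 'rV[R]_d -> R) (hf : cube_differentiable f),
  `| \int[lebesgue_rV d]_(x in @unit_cube R d) (f x)%:E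
     - (N%:R^-1 * \sum_(i : {ffun 'I_d -> 'I_m}) f (grid_point i))%R%:E |
  <= c%:E * cube_gradient_Lnorm +oo f `^ ((d%:R - 1) / d%:R)
          * cube_gradient_Lnorm 1 f `^ (1 / d%:R)
          * (N%:R `^ (- (1 / d%:R)))%R%:E.
Proof.
have d0 : (0 < d%:R :> R)%R by rewrite ltr0n.
have c0 : (0 < d%:R * (1 + 2 ^+ d) :> R)%R.
  by rewrite mulr_gt0// addr_gt0// exprn_gt0.
exists (d%:R * (1 + 2 ^+ d))%R => // m m0 N -> f df.
have mR : (0 < m%:R :> R)%R by rewrite ltr0n.
have NE : ((m ^ d)%:R `^ (- (1 / d%:R)) = m%:R^-1 :> R)%R.
  rewrite natrX -powR_mulrn ?ltW// -powRrM div1r mulrN mulfV ?gt_eqF//.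
  by rewrite powR_inv1// ltW.
rewrite NE; set c := (d%:R * _)%R in c0 *.
set M := cube_gradient_Lnorm +oo f; set I := cube_gradient_Lnorm 1 f.
have M0 : 0 <= M by exact: Lnorm_ge0.
have I0 : 0 <= I by exact: Lnorm_ge0.
have mV0 : (0 < m%:R^-1 :> R)%R by rewrite invr_gt0.
(* For d = 1 the exponent of M vanishes, so M may be infinite; for I = 0 the
   right-hand side is 0 even if M is infinite. *)
have [dI|] := boolP ((d == 1)%N || (I == 0)).
  apply: le_trans (quadrature_error_L1 hd df m0 dI) _.
  rewrite -/I.
  have [->|In0] := eqVneq I 0.
    by rewrite mule0 !mule_ge0 ?poweR_ge0 ?lee_fin ?(ltW c0) ?(ltW mV0).
  rewrite (negbTE In0) orbF in dI; have d1 := eqP dI.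
  have dR : d%:R = 1%R :> R by rewrite d1.
  have -> : (m%:R ^- d = m%:R^-1 :> R)%R by rewrite d1 expr1.
  rewrite dR subrr mul0r poweRe0 mule1 divr1 poweRe1// -muleA [I * _]muleC muleA.
  rewrite lee_wpmul2r// -EFinM lee_fin mulr1 ler_peMl ?(ltW mV0)//.
  by rewrite /c dR mul1r lerDl exprn_ge0.
rewrite negb_or => /andP[d1 In0].
have Ipos : 0 < I by rewrite lt_neqAle eq_sym In0.
have dR1 : (1 < d%:R :> R)%R by rewrite ltr1n ltn_neqAle eq_sym d1.
have ME0 : ((d%:R - 1) / d%:R != 0 :> R)%R.
  by rewrite mulf_neq0 ?invr_eq0 ?gt_eqF// subr_gt0.
(* As I <= M on a set of measure one, I > 0 excludes M = 0. *)
have Mpos (x : R) : M = x%:E -> (0 < x)%R.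
  move=> Mx; have x0 : (0 <= x)%R by rewrite -lee_fin -Mx.
  rewrite lt_neqAle x0 andbT; apply/negP => /eqP xE.
  have := integral_grad_le df Mx (@measurable_unit_cube R d) (@lebesgue_unit_cube R d).
  by rewrite -cube_gradient_Lnorm1E -/I -xE mul0r leNgt Ipos.
case ME : M M0 => [x| |] // M0; last first.
  rewrite poweRyr// gt0_muley ?lte_fin// gt0_mulye ?poweR_gt0//.
  by rewrite gt0_mulye ?leey ?lte_fin.
have x0 := Mpos x ME.
have Ix : I <= x%:E.
  have := integral_grad_le df ME (@measurable_unit_cube R d) (@lebesgue_unit_cube R d).
  by rewrite mulr1 -cube_gradient_Lnorm1E.
case IE : I Ipos Ix => [y| |] // Iy yx.
have [r [r0 rm rE]] := optimal_scale hd mR x0 Iy yx.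
apply: le_trans (quadrature_error_Loo hd df m0 ME r0 rm) _.
rewrite -/I IE !poweR_EFin -!EFinM -EFinD lee_fin rE.
exact: lexx.
Qed.
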